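(* Let $A$ and $B$ be finitely generated unital $K$-algebras over a field $K$ that are Morita equivalent. If $\mathcal{F}$ is a filtration of $A$, then there is a filtration $\mathcal{G}$ of $B$ such that $\mathrm{h}_{\mathrm{alg}}(A,\mathcal{F})=\mathrm{h}_{\mathrm{alg}}(B,\mathcal{G})$.
   Context: A filtration of a $K$-algebra $A$ is a family $\mathcal{F}=\{V_n\}_{n\ge0}$ of subspaces with $0=V_0\subseteq V_1\subseteq\cdots$, $A=\bigcup_n V_n$, and $V_nV_m\subseteq V_{n+m}$; the quotients $V_n/V_{n-1}$ are assumed finite-dimensional. The algebraic entropy is $\mathrm{h}_{\mathrm{alg}}(A,\mathcal{F})=0$ if $A$ is finite-dimensional, and otherwise $\mathrm{h}_{\mathrm{alg}}(A,\mathcal{F})=\limsup_{n\to\infty}\frac{\log\dim(V_n/V_{n-1})}{n}$ (with $\log 0=-\infty$). *)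

(* Defs.v *)
From HB Require Import structures.
From mathcomp Require Import all_boot all_order all_algebra.
From mathcomp Require Import all_classical all_reals all_analysis.
Set Implicit Arguments. Unset Strict Implicit. Unset Printing Implicit Defensive.
Import Order.TTheory GRing.Theory Num.Theory.
Local Open Scope ring_scope.

Section AlgEntropy.
Variables (K : fieldType) (A : algType K).

Definition word_val (w : seq A) : A := foldr (fun x y => x * y) 1 w.

Definition fingen_alg : Prop :=
  exists s : seq A, forall a : A,
    exists (ws : seq (seq A)) (cs : seq K),
      all (fun w => all (fun x => x \in s) w) ws /\
      a = \sum_(i < size ws) cs`_i *: word_val (nth [::] ws i).

Definition findim_alg : Prop :=
  exists s : seq A, forall a : A,
    exists cs : seq K, a = \sum_(i < size s) cs`_i *: s`_i.

Definition is_subspace (U : A -> Prop) : Prop :=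
  U 0 /\ forall (k : K) (u v : A), U u -> U v -> U (k *: u + v).

Definition spans_mod (V : nat -> A -> Prop) (n : nat) (s : seq A) : Prop :=
  (forall x, x \in s -> V n x) /\
  forall v, V n v -> exists (cs : seq K) (r : A),
      V n.-1 r /\ v = \sum_(i < size s) cs`_i *: s`_i + r.

Definition fd_quot (V : nat -> A -> Prop) (n : nat) : Prop :=
  exists s, spans_mod V n s.

(* d = dim_K (V n / V (n-1)) : the minimal size of a spanning family
   of the quotient *)
Definition is_qdim (V : nat -> A -> Prop) (n d : nat) : Prop :=
  (exists s, spans_mod V n s /\ size s = d) /\
  (forall s, spans_mod V n s -> (d <= size s)%N).

Definition qdim (V : nat -> A -> Prop) (n : nat) : nat :=
  xget 0%N [set d | is_qdim V n d].

Definition filtration (V : nat -> A -> Prop) : Prop :=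
  (forall n, is_subspace (V n)) /\
  [/\ forall x, V 0 x <-> x = 0,
      forall n x, V n x -> V n.+1 x,
      forall a, exists n, V n a,
      forall n m x y, V n x -> V m y -> V (n + m)%N (x * y)
    & forall n, fd_quot V n].

(* algebraic entropy, with log 0 = -oo; natural logarithm *)
Definition halg (R : realType) (V : nat -> A -> Prop) : \bar R :=
  if `[< findim_alg >] then 0%E
  else limn_esup (fun n : nat =>
         if qdim V n == 0%N then -oo%E
         else ((ln ((qdim V n)%:R : R)) / n%:R)%:E).

End AlgEntropy.

Definition functor_laws (A B : pzRingType)
  (F : lmodType A -> lmodType B)
  (Fm : forall M N : lmodType A, {linear M -> N} -> {linear F M -> F N}) : Prop :=
  (forall (M : lmodType A) (f : {linear M -> M}),
      (forall x, f x = x) -> forall y, Fm M M f y = y) /\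
  (forall (M N P : lmodType A) (f : {linear M -> N}) (g : {linear N -> P})
          (h : {linear M -> P}),
      (forall x, h x = g (f x)) -> forall y, Fm M P h y = Fm N P g (Fm M N f y)).

Definition nat_iso_id (A B : pzRingType)
  (F : lmodType A -> lmodType B)
  (G : lmodType B -> lmodType A)
  (Gm : forall M N : lmodType B, {linear M -> N} -> {linear G M -> G N})
  (Fm : forall M N : lmodType A, {linear M -> N} -> {linear F M -> F N}) : Prop :=
  exists eta : forall M : lmodType A, {linear M -> G (F M)},
    (forall M, bijective (eta M)) /\
    forall (M N : lmodType A) (f : {linear M -> N}) (x : M),
      eta N (f x) = Gm (F M) (F N) (Fm M N f) (eta M x).

Definition morita_equiv (A B : pzRingType) : Prop :=
  exists (F : lmodType A -> lmodType B) (G : lmodType B -> lmodType A)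
         (Fm : forall M N : lmodType A, {linear M -> N} -> {linear F M -> F N})
         (Gm : forall M N : lmodType B, {linear M -> N} -> {linear G M -> G N}),
    [/\ functor_laws Fm, functor_laws Gm,
        nat_iso_id Gm Fm & nat_iso_id Fm Gm].

(* Main.v *)
(* A Morita equivalence of rings need not respect the scalars [K], so a
   filtration cannot simply be transported.  What saves the statement is that
   most entropies are unconstrained.  Let [W k] be the span of the products of
   [k] elements of [1 :: g], where [g] generates [B], and let [d k] be its
   dimension; [d] is submultiplicative.  If [B] is infinite-dimensional and
   [psi] is superadditive, then [phi n := max {k | d k <= exp (psi n)}] is
   superadditive, and [n |-> W (phi n)] is a filtration whose dimensions are
   [exp (psi n)] up to a constant.  With [psi n = h n] and [psi n = n ^ 2] this
   realises every entropy in ]0, +oo].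

   It remains to transfer entropy zero and finite dimension.  The equivalence
   presents [B] as a corner [e M_n(A) e], by maps [mu] and [tau] that are only
   additive and multiplicative.
   - Entropy zero.  Fix [l] and write [mu] of the words of length [l] over a
     basis [X] of the relevant step of the filtration of [M_n(A)], with
     coefficients in a finite [C] in [K].  Words of length [l m] are then sums of
     (monomials of degree [m] in [C]) * (words of length [m] in [X]), and since
     [C] is commutative there are only polynomially many of the former.  So the
     growth rate in [B] is at most [#|X| ^ (1 / l)], which tends to [1].
   - Finite dimension.  If [A] is finite-dimensional, then [B] is a finite module
     over some [K[c_1, .., c_r]] with central [c_i], and every central [h]
     satisfies [h ^ N = h ^ (N + 1) u], where by Nakayama [u] may be taken in
     [K[c_1, .., c_r]].  For [h = c_1] this is a nontrivial polynomial relation,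
     and Noether normalisation lowers [r] down to [0]. *)

Require Import Defs.
From HB Require Import structures.
From mathcomp Require Import all_boot all_order all_algebra.
From mathcomp Require Import all_classical all_reals all_analysis.
From mathcomp Require Import zify ring lra.
Set Implicit Arguments. Unset Strict Implicit. Unset Printing Implicit Defensive.
Import Order.TTheory GRing.Theory Num.Theory.
Local Open Scope ring_scope.

(** * Morita equivalence and corners of matrix rings *)

Section TraceQuotient.
Variables (R : pzRingType) (P N : lmodType R).

Definition trace : {pred N} := fun x =>
  `[< exists s : seq ({linear P -> N} * P), x = \sum_(t <- s) t.1 t.2 >].

Lemma trace_zmod_closed : zmod_closed trace.
Proof.
split=> [|x y /asboolP[s ->] /asboolP[s' ->]].
  by apply/asboolP; exists [::]; rewrite big_nil.
apply/asboolP; exists (s ++ [seq (t.1, - t.2) | t <- s']).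
rewrite big_cat big_map/= -sumrN; congr (_ + _).
by apply: eq_bigr => t _; rewrite raddfN.
Qed.

HB.instance Definition _ := GRing.isZmodClosed.Build N trace trace_zmod_closed.

Lemma traceZ (a : R) (x : N) : x \in trace -> a *: x \in trace.
Proof.
move=> /asboolP[s ->]; apply/asboolP; exists [seq (t.1, a *: t.2) | t <- s].
by rewrite big_map scaler_sumr; apply: eq_bigr => t _; rewrite linearZ.
Qed.

Lemma mem_trace (t : {linear P -> N}) (p : P) : t p \in trace.
Proof. by apply/asboolP; exists [:: (t, p)]; rewrite big_seq1. Qed.

Definition quot_trace := Quotient.quot trace.
HB.instance Definition _ := GRing.Zmodule.on quot_trace.

Definition quot_trace_pi (x : N) : quot_trace := (\pi_(Quotient.quot trace) x)%qT.

Lemma quot_trace_piP (x y : N) :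
  quot_trace_pi x = quot_trace_pi y <-> x - y \in trace.
Proof. by rewrite Quotient.idealrBE; split=> [/eqP //|/eqP]. Qed.

Lemma quot_trace_piB : zmod_morphism quot_trace_pi.
Proof. by move=> x y; rewrite /quot_trace_pi raddfB. Qed.

HB.instance Definition _ :=
  GRing.isZmodMorphism.Build N quot_trace quot_trace_pi quot_trace_piB.

Definition quot_trace_scale (a : R) (x : quot_trace) : quot_trace :=
  quot_trace_pi (a *: (repr x : N)).

Lemma quot_trace_surj (x : quot_trace) : exists y, x = quot_trace_pi y.
Proof. by exists (repr x); rewrite /quot_trace_pi reprK. Qed.

Lemma quot_trace_scale_pi (a : R) (x : N) :
  quot_trace_scale a (quot_trace_pi x) = quot_trace_pi (a *: x).
Proof.
apply/quot_trace_piP; rewrite -scalerBr; apply: traceZ; apply/quot_trace_piP.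
by rewrite /quot_trace_pi reprK.
Qed.

Fact quot_trace_scaleA (a b : R) (v : quot_trace) :
  quot_trace_scale a (quot_trace_scale b v) = quot_trace_scale (a * b) v.
Proof. by have [y ->] := quot_trace_surj v; rewrite !quot_trace_scale_pi scalerA. Qed.

Fact quot_trace_scale1 : left_id 1 quot_trace_scale.
Proof. by move=> v; have [y ->] := quot_trace_surj v; rewrite quot_trace_scale_pi scale1r. Qed.

Fact quot_trace_scaleDr : right_distributive quot_trace_scale +%R.
Proof.
move=> a u v; have [x ->] := quot_trace_surj u; have [y ->] := quot_trace_surj v.
by rewrite -raddfD !quot_trace_scale_pi scalerDr raddfD.
Qed.

Fact quot_trace_scaleDl (v : quot_trace) :
  {morph quot_trace_scale^~ v : a b / a + b}.
Proof.
move=> a b; have [y ->] := quot_trace_surj v.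
by rewrite !quot_trace_scale_pi scalerDl raddfD.
Qed.

HB.instance Definition _ := GRing.Zmodule_isLmodule.Build R quot_trace
  quot_trace_scaleA quot_trace_scale1 quot_trace_scaleDr quot_trace_scaleDl.

Lemma quot_trace_pi_scalable : scalable quot_trace_pi.
Proof. by move=> a x; rewrite -quot_trace_scale_pi. Qed.

HB.instance Definition _ :=
  GRing.isScalable.Build R N quot_trace *:%R quot_trace_pi quot_trace_pi_scalable.

(* The projection onto the cokernel of the trace cannot be told apart from [0]
   by maps out of [P]. *)
Lemma separating_trace :
  (forall f g : {linear N -> quot_trace},
     (forall (t : {linear P -> N}) p, f (t p) = g (t p)) -> f =1 g) ->
  forall x : N, exists s : seq ({linear P -> N} * P), x = \sum_(t <- s) t.1 t.2.
Proof.
move=> sep x; suff: x \in trace by move=> /asboolP.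
rewrite -[x]subr0; apply/quot_trace_piP; rewrite raddf0.
apply: (sep quot_trace_pi \0) => t p /=.
by rewrite -[RHS](raddf0 quot_trace_pi); apply/quot_trace_piP; rewrite subr0 mem_trace.
Qed.

End TraceQuotient.

Section RegularModule.
Variable R : pzRingType.

Section OrbitMap.
Variables (M : lmodType R) (x : M).

Definition orbit_map (a : R^o) : M := (a : R) *: x.

Lemma orbit_map_linear : linear orbit_map.
Proof. by move=> a u v; rewrite /orbit_map scalerDl -scalerA. Qed.

HB.instance Definition _ :=
  GRing.isLinear.Build R R^o M *:%R orbit_map orbit_map_linear.

End OrbitMap.

Lemma regular_linearE (M : lmodType R) (f : {linear R^o -> M}) (a : R^o) :
  f a = (a : R) *: f (1 : R).
Proof. by rewrite -linearZ; congr (f _); rewrite /= [RHS](mulr1 (a : R)). Qed.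

Lemma linear_inverse (M N : lmodType R) (f : {linear M -> N}) :
  bijective f -> exists g : {linear N -> M}, cancel f g /\ cancel g f.
Proof.
move=> [g fK gK].
have gL : linear g by move=> a u v; apply: (can_inj fK); rewrite linearP !gK.
by exists (HB.pack_for {linear N -> M} g (GRing.isLinear.Build R N M *:%R g gL)).
Qed.

End RegularModule.

Definition linear_of (R : pzRingType) (M N : lmodType R) (f : M -> N)
    (fL : linear f) : {linear M -> N} :=
  HB.pack_for {linear M -> N} f (GRing.isLinear.Build R M N *:%R f fL).

(** * Functors and equivalences between module categories *)

Section Functor.
Variables (A B : pzRingType) (F : lmodType A -> lmodType B).
Variable Fm : forall M N : lmodType A, {linear M -> N} -> {linear F M -> F N}.
Hypothesis FmP : functor_laws Fm.

Lemma functor_id (M : lmodType A) (f : {linear M -> M}) : f =1 id -> Fm f =1 id.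
Proof. by move=> f1 y; apply: FmP.1. Qed.

Lemma functor_comp (M N P : lmodType A) (f : {linear M -> N})
    (g : {linear N -> P}) (h : {linear M -> P}) :
  h =1 g \o f -> Fm h =1 Fm g \o Fm f.
Proof. by move=> hE y; apply: FmP.2. Qed.

Lemma functor_eq (M N : lmodType A) (f g : {linear M -> N}) :
  f =1 g -> Fm f =1 Fm g.
Proof.
move=> fg y; rewrite (functor_comp (f := g) (g := idfun) (h := f)) //=.
by rewrite functor_id.
Qed.

End Functor.

(** By naturality [f] is [Gm (Fm f)] conjugated by the bijections [eta]. *)
Lemma nat_iso_faithful (A B : pzRingType)
    (F : lmodType A -> lmodType B) (G : lmodType B -> lmodType A)
    (Fm : forall M N : lmodType A, {linear M -> N} -> {linear F M -> F N})
    (Gm : forall M N : lmodType B, {linear M -> N} -> {linear G M -> G N}) :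
  functor_laws Gm -> nat_iso_id Gm Fm ->
  forall (M N : lmodType A) (f g : {linear M -> N}), Fm _ _ f =1 Fm _ _ g -> f =1 g.
Proof.
move=> GmP [eta [etab etaN]] M N f g fg x; apply: (bij_inj (etab N)).
by rewrite !etaN (functor_eq GmP fg).
Qed.

Section Equivalence.
Variables (A B : pzRingType).
Variables (F : lmodType A -> lmodType B) (G : lmodType B -> lmodType A).
Variable Fm : forall M N : lmodType A, {linear M -> N} -> {linear F M -> F N}.
Variable Gm : forall M N : lmodType B, {linear M -> N} -> {linear G M -> G N}.
Hypotheses (FmP : functor_laws Fm) (GmP : functor_laws Gm).
Hypotheses (etaP : nat_iso_id Gm Fm) (epsP : nat_iso_id Fm Gm).

Let Ffaith := nat_iso_faithful GmP etaP.
Let Gfaith := nat_iso_faithful FmP epsP.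

(** [psi] is [Gm phi] conjugated by [eta]. Naturality then gives [Gm (Fm psi) = Gm phi], and [Gm] is
    faithful. *)
Lemma functor_full (M N : lmodType A) (phi : {linear F M -> F N}) :
  exists psi : {linear M -> N}, Fm psi =1 phi.
Proof.
have [eta [etab etaN]] := etaP.
have [etaM' [etaMK etaMK']] := linear_inverse (etab M).
have [etaN' [etaNK etaNK']] := linear_inverse (etab N).
exists (etaN' \o Gm phi \o eta M); apply: Gfaith => y.
by rewrite -[y]etaMK' -etaN /= etaNK'.
Qed.

(** Fullness provides [z] with [Fm z = \0], and the zero map factors as [\0 \o z]. *)
Lemma functor0 (M N : lmodType A) : Fm (\0 : {linear M -> N}) =1 \0.
Proof.
move=> y; have [z zE] := functor_full (\0 : {linear F M -> F M}).
rewrite (functor_comp FmP (f := z) (g := \0)) /=; last by [].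
by rewrite zE /= raddf0.
Qed.

(** Additivity is not among the [functor_laws]; it is forced by fullness and the biproduct [N * N].
    The map [w] built from [Fm f] and [Fm g] has the form [Fm w'], faithfulness identifies the
    components of [w'] as [f] and [g], and [s] is [w'] followed by addition. *)
Lemma functorD (M N : lmodType A) (f g s : {linear M -> N}) :
  s =1 f \+ g -> Fm s =1 Fm f \+ Fm g.
Proof.
move=> sE y.
have addL : linear (fun p : N * N => p.1 + p.2).
  by move=> a u v /=; rewrite scalerDr addrACA.
have hL : linear (fun x : M => (f x, g x)).
  by move=> a u v; rewrite !linearP.
have i1L : linear (fun x : N => (x, 0) : N * N).
  by move=> a u v; rewrite -[RHS]/(a *: u + v, a *: 0 + 0) scaler0 addr0.
have i2L : linear (fun x : N => (0, x) : N * N).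
  by move=> a u v; rewrite -[RHS]/(a *: 0 + 0, a *: u + v) scaler0 addr0.
have p1L : linear (fun p : N * N => p.1) by [].
have p2L : linear (fun p : N * N => p.2) by [].
pose i1 := linear_of i1L; pose i2 := linear_of i2L.
pose p1 := linear_of p1L; pose p2 := linear_of p2L.
pose w : {linear F M -> F (N * N)%type} :=
  (Fm i1 \o Fm f) \+ (Fm i2 \o Fm g).
have FK (P Q : lmodType A) (u : {linear P -> Q}) (v : {linear Q -> P}) z :
    v \o u =1 id -> Fm v (Fm u z) = z.
  move=> uv; rewrite -[LHS](functor_comp FmP (h := v \o u)) //.
  by rewrite (functor_id FmP).
have F0 (P Q S : lmodType A) (u : {linear P -> Q}) (v : {linear Q -> S}) z :
    v \o u =1 \0 -> Fm v (Fm u z) = 0.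
  by move=> uv; rewrite -[LHS](functor_comp FmP (h := \0)) ?functor0.
have [w' w'E] := functor_full w.
have w1 : p1 \o w' =1 f.
  apply: Ffaith => z; rewrite (functor_comp FmP (f := w') (g := p1)) //= w'E /=.
  by rewrite raddfD /= FK // F0 // addr0.
have w2 : p2 \o w' =1 g.
  apply: Ffaith => z; rewrite (functor_comp FmP (f := w') (g := p2)) //= w'E /=.
  by rewrite raddfD /= F0 // FK // add0r.
rewrite (functor_comp FmP (f := w') (g := linear_of addL)) /=; last first.
  by move=> x; rewrite sE /= -w1 -w2.
rewrite w'E /= raddfD /= !FK //= => x /=; first by rewrite add0r.
by rewrite addr0.
Qed.

(** [F A^o] is a generator because [A^o] is: an element [x] of [G M] is the image of [1] under
    [orbit_map x], and [eps] turns [Fm (orbit_map x)] into a map from [F A^o] to [M]. *)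
Lemma functor_regular_separating (M N : lmodType B) (f g : {linear M -> N}) :
  (forall (t : {linear F A^o -> M}) p, f (t p) = g (t p)) -> f =1 g.
Proof.
move=> fg; apply: Gfaith => x.
have [eps [epsb epsN]] := epsP.
have [epsM' [epsMK epsMK']] := linear_inverse (epsb M).
suff /(_ 1) : (Gm f \o orbit_map x) =1 (Gm g \o orbit_map x).
  by rewrite /= /orbit_map scale1r.
apply: Ffaith => p.
rewrite (functor_comp FmP (f := orbit_map x) (g := Gm f)) //=.
rewrite (functor_comp FmP (f := orbit_map x) (g := Gm g)) //=.
rewrite -[Fm (orbit_map x) p]epsMK' -!epsN.
by congr (eps _ _); apply: (fg (epsM' \o Fm (orbit_map x))).
Qed.

Lemma functor_regular_trace (M : lmodType B) (x : M) :
  exists s : seq ({linear F A^o -> M} * F A^o), x = \sum_(t <- s) t.1 t.2.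
Proof. by apply: separating_trace; apply: functor_regular_separating. Qed.

Local Notation P := (F A^o).
(** [orbit_map a] is right multiplication by [a], so [phi] is an isomorphism from the opposite ring
    of [A] onto the endomorphisms of [P]. *)
Let phi (a : A) : {linear P -> P} := Fm (orbit_map (a : A^o)).

Let phi_inj a a' : phi a =1 phi a' -> a = a'.
Proof.
by move=> /Ffaith /(_ (1 : A)); rewrite /= /orbit_map /GRing.scale /= !mul1r.
Qed.

Let phi_full (f : {linear P -> P}) : exists a, phi a =1 f.
Proof.
have [psi psiE] := functor_full f; exists (psi (1 : A)) => p.
rewrite -psiE; apply: (functor_eq FmP) => a.
by rewrite [RHS]regular_linearE.
Qed.

Let phiD a a' : phi (a + a') =1 phi a \+ phi a'.
Proof. by apply: functorD => x; rewrite /= /orbit_map scalerDr. Qed.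

Let phiM a a' : phi (a * a') =1 phi a' \o phi a.
Proof.
apply: (functor_comp FmP) => x.
by rewrite /= /orbit_map /GRing.scale /= mulrA.
Qed.

Let phi0 : phi 0 =1 \0.
Proof.
move=> p; rewrite -(@functor0 A^o A^o).
by apply: (functor_eq FmP) => x; rewrite /= /orbit_map scaler0.
Qed.

Let phi_sum (I : Type) (r : seq I) (c : I -> A) p :
  phi (\sum_(i <- r) c i) p = \sum_(i <- r) phi (c i) p.
Proof.
elim: r => [|i r IH]; first by rewrite !big_nil phi0.
by rewrite !big_cons phiD /= IH.
Qed.

(** Writing [1] as a sum of values of maps from [P] to [B] makes [B] a direct summand of [P ^ n],
    via [alpha] and [beta]. Endomorphisms of [B] thereby become matrices over the endomorphisms of
    [P], and [mu 1] is the idempotent of the summand. Both [rho] and [phi] reverse products, so [mu]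
    preserves them. *)
Lemma equivalence_corner : exists (n : nat)
    (mu : {additive B -> 'M[A]_n}) (tau : {additive 'M[A]_n -> B}),
  [/\ {morph mu : x y / x * y}, cancel mu tau
    & forall X, mu (tau X) = mu 1 * X * mu 1].
Proof.
have [s s1] := functor_regular_trace ((1 : B) : B^o).
pose n := size s.
pose t0 : {linear P -> B^o} * P :=
  ((\0 : {linear P -> B^o}), 0).
pose beta (k : 'I_n) : {linear P -> B^o} := (nth t0 s k).1.
pose alpha (k : 'I_n) : {linear B^o -> P} := orbit_map ((nth t0 s k).2 : P).
have ba b : \sum_k beta k (alpha k b) = b.
  transitivity ((b : B) *: ((1 : B) : B^o)); last exact: mulr1.
  rewrite s1 (big_nth t0) big_mkord scaler_sumr.
  by apply: eq_bigr => k _; rewrite /beta /alpha /= /orbit_map linearZ.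
pose res (f : {linear P -> P}) : A := sval (cid (phi_full f)).
have resE f : phi (res f) =1 f by rewrite /res; case: cid.
pose rho (b : B) : {linear B^o -> B^o} := orbit_map (b : B^o).
have rhoE b x : rho b x = (x : B) * b by [].
pose mu_ b : 'M[A]_n := \matrix_(k, l) res (alpha l \o rho b \o beta k).
have muE b k l p : phi (mu_ b k l) p = alpha l (rho b (beta k p)).
  by rewrite mxE resE.
pose tau_ (X : 'M[A]_n) : B :=
  \sum_k \sum_l beta l (phi (X k l) (alpha k (1 : B))).
(* The left side is [B]-linear in [b], hence it is right multiplication by its value at [1]. *)
have tauE (X : 'M[A]_n) (b : B) :
    \sum_k \sum_l beta l (phi (X k l) (alpha k b)) = b * tau_ X.
  rewrite /tau_ mulr_sumr; apply: eq_bigr => k _; rewrite mulr_sumr.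
  apply: eq_bigr => l _.
  by rewrite [alpha k b]regular_linearE !linearZ.
have muB : zmod_morphism mu_.
  move=> b b'; apply/matrixP => k l; rewrite !mxE; apply/eqP; rewrite eq_sym subr_eq; apply/eqP.
  apply: phi_inj => p; rewrite phiD /= !resE /=.
  by rewrite -raddfD; congr (alpha _ _); rewrite !rhoE mulrBr subrK.
have tauB : zmod_morphism tau_.
  move=> X Y; apply/eqP; rewrite eq_sym subr_eq eq_sym; apply/eqP.
  rewrite /tau_ -big_split; apply: eq_bigr => k _; rewrite -big_split.
  apply: eq_bigr => l _ /=; rewrite -raddfD; congr (beta _ _).
  by rewrite -[LHS]phiD !mxE subrK.
pose mu : {additive B -> 'M[A]_n} := HB.pack_for {additive B -> 'M[A]_n} mu_
  (GRing.isZmodMorphism.Build _ _ mu_ muB).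
pose tau : {additive 'M[A]_n -> B} := HB.pack_for {additive 'M[A]_n -> B} tau_
  (GRing.isZmodMorphism.Build _ _ tau_ tauB).
have mu'E b k l p : phi (mu b k l) p = alpha l (rho b (beta k p)) by exact: muE.
exists n, mu, tau; split=> [b b'|b|X].
- apply/matrixP => k l; rewrite [RHS]mxE; apply: phi_inj => p.
  rewrite mu'E phi_sum.
  under eq_bigr do rewrite phiM /= !mu'E.
  rewrite -raddf_sum; congr (alpha _ _); rewrite !rhoE mulrA.
  under eq_bigr do rewrite rhoE.
  by rewrite -mulr_suml [in RHS]ba.
- rewrite /= /tau_; under eq_bigr do under eq_bigr do rewrite mu'E.
  under eq_bigr do rewrite ba rhoE.
  by rewrite -mulr_suml [X in X * _]ba mul1r.
apply/matrixP => k l; apply: phi_inj => p.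
rewrite mu'E rhoE -tauE [in RHS]mxE phi_sum.
under [RHS]eq_bigr do rewrite phiM /= mu'E rhoE mulr1 [in X in alpha _ X]mxE phi_sum.
rewrite exchange_big raddf_sum; apply: eq_bigr => q _ /=.
rewrite !raddf_sum; apply: eq_bigr => j _.
by rewrite phiM /= mu'E rhoE mulr1.
Qed.

End Equivalence.

Lemma morita_equiv_sym (A B : pzRingType) : morita_equiv A B -> morita_equiv B A.
Proof.
by move=> [F [G [Fm [Gm [FmP GmP etaP epsP]]]]]; exists G, F, Gm, Fm; split.
Qed.

(** * Linear spans *)

Section Span.
Variables (K : fieldType) (V : lmodType K).
Implicit Types (s : seq V) (x y z : V) (U : V -> Prop).

(** The recursion on the list suits inductions; [kspanP] converts to the coefficient sums of
    [findim_alg] and [spans_mod]. *)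
Fixpoint kspan s y : Prop :=
  if s is m :: s' then exists c z, kspan s' z /\ y = c *: m + z else y = 0.

Definition subspace_pred U :=
  U 0 /\ forall (k : K) u v, U u -> U v -> U (k *: u + v).

Lemma subspace_predD U u v : subspace_pred U -> U u -> U v -> U (u + v).
Proof. by move=> [_ UP] Uu Uv; rewrite -[u]scale1r; apply: UP. Qed.

Lemma subspace_predZ U k u : subspace_pred U -> U u -> U (k *: u).
Proof. by move=> [U0 UP] Uu; rewrite -[_ *: _]addr0; apply: UP. Qed.

Lemma subspace_pred_sum U (I : eqType) (r : seq I) (F : I -> V) :
  subspace_pred U -> {in r, forall i, U (F i)} -> U (\sum_(i <- r) F i).
Proof.
move=> UP; elim: r => [_|i r IH UF]; first by rewrite big_nil; case: UP.
rewrite big_cons; apply: subspace_predD => //; first by apply: UF; rewrite mem_head.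
by apply: IH => j jr; apply: UF; rewrite inE jr orbT.
Qed.

Lemma kspan_subspace s : subspace_pred (kspan s).
Proof.
split; first by elim: s => //= m s IH; exists 0, 0; rewrite scale0r addr0.
elim: s => [k u v /= -> ->|m s IH k u v /=]; first by rewrite scaler0 addr0.
move=> [c [z [zs ->]]] [c' [z' [zs' ->]]].
exists (k * c + c'), (k *: z + z'); split; first exact: IH.
by rewrite scalerDr scalerDl scalerA addrACA.
Qed.

Lemma kspanD s x y : kspan s x -> kspan s y -> kspan s (x + y).
Proof. exact: subspace_predD (kspan_subspace s). Qed.

Lemma kspanZ s k x : kspan s x -> kspan s (k *: x).
Proof. exact: subspace_predZ (kspan_subspace s). Qed.

Lemma kspanN s x : kspan s x -> kspan s (- x).
Proof. by rewrite -scaleN1r; apply: kspanZ. Qed.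

Lemma kspan_mem s x : x \in s -> kspan s x.
Proof.
elim: s => //= m s IH; rewrite inE => /predU1P[->|/IH xs].
  by exists 1, 0; rewrite scale1r addr0; split=> //; case: (kspan_subspace s).
by exists 0, x; rewrite scale0r add0r.
Qed.

Lemma kspan_min U s y :
  subspace_pred U -> {in s, forall x, U x} -> kspan s y -> U y.
Proof.
move=> UP; elim: s y => [y _ -> | m s IH y sU [c [z [zs ->]]]]; first by case: UP.
apply: UP.2; first by apply: sU; rewrite mem_head.
by apply: IH => // x xs; apply: sU; rewrite inE xs orbT.
Qed.

Lemma kspan_trans s s' y : {in s, forall x, kspan s' x} -> kspan s y -> kspan s' y.
Proof. exact: kspan_min (kspan_subspace s'). Qed.

Lemma kspan_sub s s' y : {subset s <= s'} -> kspan s y -> kspan s' y.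
Proof. by move=> ss; apply: kspan_trans => x /ss /kspan_mem. Qed.

Lemma kspanP s y :
  kspan s y <-> exists cs : seq K, y = \sum_(i < size s) cs`_i *: s`_i.
Proof.
elim: s y => [|m s IH] y /=.
  by split=> [->|[cs ->]]; [exists [::]|]; rewrite big_ord0.
split=> [[c [z [/IH[cs ->] ->]]]|[cs ->]].
  by exists (c :: cs); rewrite big_ord_recl.
rewrite big_ord_recl; exists cs`_0; eexists; split; last by [].
by apply/IH; exists (behead cs); apply: eq_bigr => i _; rewrite /= nth_behead.
Qed.

Lemma kspan_family s (I : finType) (x : I -> V) :
  (forall i, kspan s (x i)) ->
  exists c : I -> 'I_(size s) -> K, forall i, x i = \sum_j c i j *: s`_j.
Proof.
move=> xs; have [cs csE] := choice (fun i => (kspanP s (x i)).1 (xs i)).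
by exists (fun i j => (cs i)`_j).
Qed.

(** Inside the span of [m :: s], a subspace is generated by its intersection with the span of [s]
    and at most one further vector, one with nonzero coefficient at [m]. *)
Lemma steinitz U s : subspace_pred U -> (forall x, U x -> kspan s x) ->
  exists2 s', (size s' <= size s)%N &
    {in s', forall x, U x} /\ forall x, U x -> kspan s' x.
Proof.
elim: s U => [|m s IH] U UP Us /=; first by exists [::].
pose U' x := U x /\ kspan s x.
have U'P : subspace_pred U'.
  split; first by split; [case: UP | case: (kspan_subspace s)].
  move=> k u v [Uu us] [Uv vs]; split; first exact: UP.2.
  exact: (kspan_subspace s).2.
have [|s' ss' [s'U' U's']] := IH U' U'P; first by move=> x [].
have [[u [Uu us]]|sU] := pselect (exists x, U x /\ ~ kspan s x); last first.
  exists s'; first exact: leqW.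
  split=> [x /s'U'[]//|x Ux]; apply: U's'; split=> //.
  by apply: contrapT => xs; apply: sU; exists x.
exists (u :: s') => //; split=> [x|x Ux].
  by rewrite inE => /predU1P[->//|/s'U'[]].
have [c [z [zs uE]]] := Us u Uu; have [c' [z' [zs' xE]]] := Us x Ux.
have c0 : c != 0 by apply/eqP => c0; apply: us; rewrite uE c0 scale0r add0r.
exists (c' / c), (x - (c' / c) *: u); split; last by rewrite addrC subrK.
apply: U's'; split.
  by rewrite -scaleNr addrC; apply: UP.2.
rewrite uE xE scalerDr scalerA divfK // opprD addrACA subrr add0r.
by apply: kspanD => //; apply: kspanN; apply: kspanZ.
Qed.

Lemma kspan_dependent s (x : nat -> V) :
  (forall i, kspan s (x i)) ->
  exists2 c : 'I_(size s).+1 -> K, (exists i, c i != 0) & \sum_i c i *: x i = 0.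
Proof.
move=> xs; pose N := size s.
have [c cE] := kspan_family (x := fun i : 'I_N.+1 => x i) (fun i => xs i).
pose M : 'M[K]_(N.+1, N) := \matrix_(i, j) c i j.
have : kermx M != 0.
  by rewrite kermx_eq0 /row_free neq_ltn ltnS rank_leq_col.
move=> /rowV0Pn[v /sub_kermxP vM /rV0Pn[i vi]].
exists (fun i => v 0 i); first by exists i.
under eq_bigr do rewrite cE scaler_sumr.
rewrite exchange_big big1 // => j _.
have vMj : \sum_i v 0 i * c i j = 0.
  have /rowP/(_ j) := vM; rewrite !mxE => vM0; rewrite -[RHS]vM0.
  by apply: eq_bigr => k _; rewrite mxE.
by under eq_bigr do rewrite scalerA; rewrite -scaler_suml vMj scale0r.
Qed.

(** A dependence is solved for its least index with nonzero coefficient, so only later vectors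
    appear on the right. For powers of an element this yields a relation [h ^ N = h ^ (N + 1) u]. *)
Lemma kspan_dependent_min s (x : nat -> V) : (forall i, kspan s (x i)) ->
  exists2 j, (j <= size s)%N & exists c : nat -> K,
    x j = \sum_(j.+1 <= i < (size s).+1) c i *: x i.
Proof.
move=> xs; have [c [i0 ci0] c0] := kspan_dependent xs; set n := size s in c c0 i0 ci0 *.
have exP : exists i, (i <= n)%N && (c (inord i) != 0).
  by exists i0; rewrite -ltnS ltn_ord inord_val.
have [j /andP[jn cj] jmin] := ex_minnP exP; exists j => //.
exists (fun i => - (c (inord j))^-1 * c (inord i)).
under eq_bigr do rewrite -scalerA; rewrite -scaler_sumr.
have : \sum_(0 <= i < n.+1) c (inord i) *: x i = 0.
  by rewrite big_mkord -[RHS]c0; apply: eq_bigr => i _; rewrite inord_val.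
rewrite (big_cat_nat (n := j)) //=; last exact: leqW.
rewrite big_nat_cond big1 ?add0r => [|i /andP[/andP[_ ij] _]]; last first.
  apply/eqP; rewrite scaler_eq0; apply/orP; left; apply/negPn/negP => ci.
  have := jmin i; rewrite ci andbT (leq_trans (ltnW ij) jn) => /(_ isT).
  by rewrite leqNgt ij.
rewrite big_ltn ?ltnS // => /eqP; rewrite addr_eq0 => /eqP cE.
by rewrite scaleNr -scalerN -cE scalerA mulVf // scale1r.
Qed.

(** For a subspace this bounds the dimension by [N], since [steinitz] moves the spanning list inside
    [U]. *)
Definition rank_le U (N : nat) :=
  exists2 s, (size s <= N)%N & forall x, U x -> kspan s x.

Lemma rank_le_sub U U' N : (forall x, U x -> U' x) -> rank_le U' N -> rank_le U N.
Proof. by move=> UU' [s sN sU]; exists s => // x /UU'/sU. Qed.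

Lemma rank_leW U N N' : (N <= N')%N -> rank_le U N -> rank_le U N'.
Proof. by move=> NN' [s sN sU]; exists s => //; apply: leq_trans NN'. Qed.

End Span.

Lemma kspan_mul (K : fieldType) (B : algType K) (s t : seq B) (x y : B) :
  kspan s x -> kspan t y -> kspan [seq a * b | a <- s, b <- t] (x * y).
Proof.
move=> xs yt; pose W := kspan [seq a * b | a <- s, b <- t].
have WP : subspace_pred W by apply: kspan_subspace.
apply: (kspan_min (U := fun x => W (x * y))) xs.
  split=> [|k u v]; first by rewrite mul0r; case: WP.
  by move=> Wu Wv; rewrite mulrDl -scalerAl; apply: WP.2.
move=> a sa; apply: (kspan_min (U := fun y => W (a * y))) yt.
  split=> [|k u v]; first by rewrite mulr0; case: WP.
  by move=> Wu Wv; rewrite mulrDr -scalerAr; apply: WP.2.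
by move=> b tb; apply: kspan_mem; apply: allpairs_f.
Qed.

(** * Central subalgebras and Noether normalisation *)

Section CentralSubalgebras.
Variables (K : fieldType) (B : algType K).
Implicit Types (S : B -> Prop) (c ms : seq B) (x y : B).

Definition central x := forall y, x * y = y * x.

Record subalg_pred S : Prop := SubalgPred {
  subalg_subspace : subspace_pred S;
  subalg1 : S 1;
  subalgM : forall x y, S x -> S y -> S (x * y) }.

Lemma subalg0 S : subalg_pred S -> S 0.
Proof. by case=> -[]. Qed.

Lemma subalgD S x y : subalg_pred S -> S x -> S y -> S (x + y).
Proof. by move=> SP; apply: subspace_predD (subalg_subspace SP). Qed.

Lemma subalgZ S k x : subalg_pred S -> S x -> S (k *: x).
Proof. by move=> SP; apply: subspace_predZ (subalg_subspace SP). Qed.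

Lemma subalgB S x y : subalg_pred S -> S x -> S y -> S (x - y).
Proof.
by move=> SP Sx Sy; apply: subalgD => //; rewrite -scaleN1r; apply: subalgZ.
Qed.

Lemma subalgX S x n : subalg_pred S -> S x -> S (x ^+ n).
Proof.
move=> SP Sx; elim: n => [|n IH]; first by rewrite expr0; apply: subalg1.
by rewrite exprS; apply: subalgM.
Qed.

Lemma central_subalg : subalg_pred central.
Proof.
split=> [|y|x y xC yC z]; last by rewrite -mulrA yC mulrA xC mulrA.
  split=> [y|k u v uC vC y]; first by rewrite mul0r mulr0.
  by rewrite mulrDl mulrDr vC -scalerAl -scalerAr uC.
by rewrite mul1r mulr1.
Qed.

Lemma centralCA x y z : central x -> x * (y * z) = y * (x * z).
Proof. by move=> xC; rewrite mulrA xC mulrA. Qed.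

Definition kgen c x := forall S, subalg_pred S -> {in c, forall y, S y} -> S x.

Lemma kgen_subalg c : subalg_pred (kgen c).
Proof.
split=> [|S SP cS|x y xc yc S SP cS]; last by apply: subalgM => //; [apply: xc | apply: yc].
  split=> [S SP cS|k u v uc vc S SP cS]; first exact: subalg0.
  by apply: subalgD => //; [apply: subalgZ => //; apply: uc | apply: vc].
exact: subalg1.
Qed.

Lemma kgen_mem c x : x \in c -> kgen c x.
Proof. by move=> xc S SP; apply. Qed.

Lemma kgen_central c x : {in c, forall y, central y} -> kgen c x -> central x.
Proof. by move=> cC; apply=> //; apply: central_subalg. Qed.

Lemma kgen_nil x : kgen [::] x -> exists k : K, x = k%:A.
Proof.
move=> /(_ (fun x => exists k : K, x = k%:A)); apply=> //.
split; [split; [|move=> k _ _ [a ->] [b ->]] | |move=> _ _ [a ->] [b ->]].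
- by exists 0; rewrite scale0r.
- by exists (k * a + b); rewrite scalerDl scalerA.
- by exists 1; rewrite scale1r.
- by exists (a * b); rewrite -scalerAl mul1r scalerA.
Qed.

Fixpoint sspan S ms y : Prop :=
  if ms is m :: ms' then exists s z, [/\ S s, sspan S ms' z & y = s * m + z]
  else y = 0.

Section SubalgSpan.
Variables (S : B -> Prop).
Hypotheses (SP : subalg_pred S) (SC : forall x, S x -> central x).

Lemma sspan0 ms : sspan S ms 0.
Proof.
elim: ms => //= m ms IH; exists 0, 0; split=> //; first exact: subalg0.
by rewrite mul0r addr0.
Qed.

Lemma sspanD ms x y : sspan S ms x -> sspan S ms y -> sspan S ms (x + y).
Proof.
elim: ms x y => [|m ms IH] x y /=; first by move=> -> ->; rewrite addr0.
move=> [s [z [Ss zs ->]]] [s' [z' [Ss' zs' ->]]].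
exists (s + s'), (z + z'); split; [exact: subalgD | exact: IH |].
by rewrite mulrDl addrACA.
Qed.

Lemma sspanM ms s x : S s -> sspan S ms x -> sspan S ms (s * x).
Proof.
move=> Ss; elim: ms x => [|m ms IH] x /=; first by move=> ->; rewrite mulr0.
move=> [s' [z [Ss' zs ->]]]; exists (s * s'), (s * z).
by split; [exact: subalgM | exact: IH |rewrite mulrDr mulrA].
Qed.

Lemma sspan_subspace ms : subspace_pred (sspan S ms).
Proof.
split=> [|k u v us vs]; first exact: sspan0.
rewrite -[u]mul1r scalerAl; apply: sspanD => //; apply: sspanM => //.
by apply: subalgZ => //; apply: subalg1.
Qed.

Lemma sspanB ms x y : sspan S ms x -> sspan S ms y -> sspan S ms (x - y).
Proof.
move=> xs ys; rewrite -scaleN1r; apply: sspanD => //.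
by apply: subspace_predZ ys; apply: sspan_subspace.
Qed.

Lemma sspan_mem ms x : x \in ms -> sspan S ms x.
Proof.
elim: ms => //= m ms IH; rewrite inE => /predU1P[->|/IH xs].
  by exists 1, 0; rewrite mul1r addr0; split=> //; [exact: subalg1 | exact: sspan0].
by exists 0, x; rewrite mul0r add0r; split=> //; exact: subalg0.
Qed.

Lemma sspan_min (U : B -> Prop) ms y :
  U 0 -> (forall x z, U x -> U z -> U (x + z)) ->
  (forall s m, S s -> m \in ms -> U (s * m)) -> sspan S ms y -> U y.
Proof.
move=> U0 UD; elim: ms y => [y _ -> //| m ms IH y UM [s [z [Ss zs ->]]]].
apply: UD; first by apply: UM => //; rewrite mem_head.
by apply: IH zs => s' m' Ss' m'ms; apply: UM; rewrite // inE m'ms orbT.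
Qed.

Lemma sspan_trans ms ms' y :
  {in ms, forall m, sspan S ms' m} -> sspan S ms y -> sspan S ms' y.
Proof.
move=> mm; apply: sspan_min; [exact: sspan0|exact: sspanD|].
by move=> s m Ss /mm; apply: sspanM.
Qed.

Lemma sspan_mul ms ms' x y : sspan S ms x -> sspan S ms' y ->
  sspan S [seq a * b | a <- ms, b <- ms'] (x * y).
Proof.
move=> xs ys; apply: (sspan_min (U := fun x => sspan S _ (x * y))) xs.
- by rewrite mul0r; apply: sspan0.
- by move=> u v us vs; rewrite mulrDl; apply: sspanD.
move=> s a Ss ams; rewrite -mulrA; apply: sspanM => //.
apply: (sspan_min (U := fun y => sspan S _ (a * y))) ys.
- by rewrite mulr0; apply: sspan0.
- by move=> u v us vs; rewrite mulrDr; apply: sspanD.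
move=> s' b Ss' bms; rewrite mulrA -(SC Ss') -mulrA; apply: sspanM => //.
by apply: sspan_mem; apply: allpairs_f.
Qed.

(** Generators are eliminated one at a time, without determinants. From [m0 = h * (s0 * m0 + z0)]
    and [q = 1 - h * s0] one gets [q * m0 = h * z0], which removes [m0] from the equations of the
    others. If [g] serves those, then [(1 - h * g) * q] kills every generator, and expanding it
    gives the new [g]. *)
Lemma nakayama (h : B) ms : S h ->
  {in ms, forall m, exists2 y, sspan S ms y & m = h * y} ->
  exists2 g, S g & {in ms, forall m, m = h * g * m}.
Proof.
move=> Sh; elim: ms => [|m0 ms IH] hm; first by exists 0 => //; exact: subalg0.
have [_ [s0 [z0 [Ss0 z0s ->]]] m0E] := hm m0 (mem_head _ _).
pose q := 1 - h * s0.
have Sq : S q by apply: subalgB (subalg1 SP) _; rewrite //; apply: subalgM.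
have qm0 : q * m0 = h * z0.
  by rewrite /q mulrBl mul1r {1}m0E mulrDr mulrA addrAC subrr add0r.
have [|g Sg gE] := IH.
  move=> m mms; have [|_ [s [z [Ss zs ->]]] mE] := hm m; first by rewrite inE mms orbT.
  exists (s0 * m + (s * (h * z0) + q * z)).
    apply: sspanD; first by apply: sspanM => //; apply: sspan_mem.
    by apply: sspanD; do 3?[apply: sspanM => //].
  rewrite -qm0 (centralCA _ _ (SC Ss)) -mulrDr [RHS]mulrDr.
  rewrite [h * (q * _)](centralCA _ _ (SC Sh)) -mE mulrA -mulrDl /q.
  by rewrite addrC subrK mul1r.
exists (g + s0 - h * g * s0) => [|m].
  by apply: subalgB => //; [apply: subalgD|do 2?apply: subalgM].
have gz z : sspan S ms z -> z = h * g * z.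
  apply: (sspan_min (U := fun z => z = h * g * z)) => [|x y xE yE|s m' Ss m'ms].
  - by rewrite mulr0.
  - by rewrite mulrDr -xE -yE.
  by rewrite mulrA -(SC Ss) -mulrA -gE.
rewrite inE => mm.
suff mE : (1 - h * g) * (q * m) = 0.
  apply/eqP; rewrite -subr_eq0 -{1}[m]mul1r -mulrBl -mE mulrA; apply/eqP; congr (_ * m).
  have abc (a b d : B) : 1 - (a + b - d) = 1 - b - (a - d).
    by rewrite !opprB opprD -[RHS]addrA [- b + _]addrC -!addrA.
  rewrite /q [RHS]mulrBl mul1r [h * g * (1 - _)]mulrBr mulr1.
  by rewrite mulrBr mulrDr abc -!mulrA [g * (h * _)](centralCA _ _ (SC Sg)) (SC Sg).
have Shg : S (h * g) by apply: subalgM.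
have hg0 z : sspan S ms z -> (1 - h * g) * z = 0.
  by move=> /gz zE; rewrite mulrBl mul1r -zE subrr.
case/predU1P: mm => [->|mms].
  by rewrite qm0; apply: hg0; apply: sspanM.
by apply: hg0; apply: sspanM => //; apply: sspan_mem.
Qed.

(** Polynomials of degree less than [d] in [x] over [S]. As [x] may be algebraic over [S], this and
    [monic_at] assert that some such expression exists, not that a degree is well defined. *)
Definition low (x : B) (d : nat) := sspan S (mkseq (fun i => x ^+ i) d).

Lemma low_exp x d i : (i < d)%N -> low x d (x ^+ i).
Proof. by move=> id; apply: sspan_mem; apply/mapP; exists i; rewrite // mem_iota. Qed.

Lemma low_sub x d d' y : (d <= d')%N -> low x d y -> low x d' y.
Proof.
move=> dd'; apply: sspan_trans => _ /mapP[i + ->]; rewrite mem_iota => /andP[_ id].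
by apply: low_exp; apply: leq_trans id dd'.
Qed.

Lemma low_mul x d d' y y' : low x d y -> low x d' y' -> low x (d + d') (y * y').
Proof.
move=> yd y'd; apply: sspan_trans (sspan_mul yd y'd) => _ /allpairsP[[a b] /= [ad bd ->]].
move: ad bd => /mapP[i + ->] /mapP[j + ->]; rewrite !mem_iota !add0n => /andP[_ id] /andP[_ jd].
by rewrite -exprD; apply: low_exp; lia.
Qed.

Lemma lowD x d y y' : low x d y -> low x d y' -> low x d (y + y').
Proof. exact: sspanD. Qed.

Lemma lowB x d y y' : low x d y -> low x d y' -> low x d (y - y').
Proof. exact: sspanB. Qed.

Definition monic_at (x : B) (d : nat) (y : B) := low x d (y - x ^+ d).

Lemma monic_at_low x d y : monic_at x d y -> low x d.+1 y.
Proof.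
move=> yd; rewrite -[y](subrK (x ^+ d)); apply: lowD; last exact: low_exp.
exact: low_sub yd.
Qed.

Lemma monic_at_exp x d : monic_at x d (x ^+ d).
Proof. by rewrite /monic_at subrr; apply: sspan0. Qed.

Lemma monic_atM x d d' y y' : monic_at x d y -> monic_at x d' y' ->
  monic_at x (d + d') (y * y').
Proof.
rewrite /monic_at => yd y'd.
have -> : y * y' - x ^+ (d + d') =
    (y - x ^+ d) * (y' - x ^+ d') + (y - x ^+ d) * x ^+ d' + x ^+ d * (y' - x ^+ d').
  by rewrite exprD -mulrDr subrK mulrBl mulrBr addrA subrK.
have xd n m l : low x n l -> low x (n + m) (l * x ^+ m) /\ low x (m + n) (x ^+ m * l).
  move=> ln; split.
    apply: (sspan_min (U := fun l => low x (n + m) (l * x ^+ m))) ln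
      => [|u v|s _ Ss /mapP[i + ->]]; rewrite ?mul0r.
    - exact: sspan0.
    - by rewrite mulrDl; apply: lowD.
    rewrite mem_iota -mulrA -exprD => /andP[_ id]; apply: sspanM => //.
    by apply: low_exp; lia.
  apply: (sspan_min (U := fun l => low x (m + n) (x ^+ m * l))) ln
    => [|u v|s _ Ss /mapP[i + ->]]; rewrite ?mulr0.
  - exact: sspan0.
  - by rewrite mulrDr; apply: lowD.
  rewrite mem_iota -(centralCA _ _ (SC Ss)) -exprD => /andP[_ id]; apply: sspanM => //.
  by apply: low_exp; lia.
apply: lowD; last exact: (xd _ d _ y'd).2.
by apply: lowD; [exact: low_mul | exact: (xd _ d' _ yd).1].
Qed.

Lemma monic_atX x d y n : monic_at x d y -> monic_at x (d * n) (y ^+ n).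
Proof.
move=> yd; elim: n => [|n IH]; first by rewrite muln0 expr0 -(expr0 x); apply: monic_at_exp.
by rewrite exprS mulnS; apply: monic_atM.
Qed.

Fixpoint mon c (e : seq nat) : B :=
  match c, e with a :: c', i :: e' => a ^+ i * mon c' e' | _, _ => 1 end.

Fixpoint digit_val (D : nat) (e : seq nat) : nat :=
  if e is i :: e' then (i + D * digit_val D e')%N else 0.

(** Nagata's change of variables: the generator at position [i] is replaced by its difference with
    [x ^ (W * D ^ i)]. *)
Fixpoint nagata_shift (x : B) (W D : nat) c : seq B :=
  if c is a :: c' then (a - x ^+ W) :: nagata_shift x (W * D) D c' else [::].

(** Over the shifted generators, each old one is monic in [x], of degree [W], [W * D], and so on;
    degrees add in products. Reading exponents as digits in base [D] then gives distinct monomials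
    distinct degrees, once [D] exceeds all exponents. *)
Lemma monic_at_mon x W D c e : (0 < D)%N -> (0 < W)%N -> size e = size c ->
  {in nagata_shift x W D c, forall y, S y} ->
  monic_at x (W * digit_val D e) (mon c e).
Proof.
move=> D0; elim: c W e => [|a c IH] W [|i e] //= W0.
  by move=> _ _; rewrite muln0; apply: (monic_at_exp x 0).
move=> [se] Sc; rewrite mulnDr mulnA; apply: monic_atM.
  apply: monic_atX; rewrite /monic_at.
  have -> : a - x ^+ W = (a - x ^+ W) * x ^+ 0 by rewrite mulr1.
  by apply: sspanM; [apply: Sc; rewrite mem_head | apply: low_exp].
apply: IH => //; first by rewrite muln_gt0 W0.
by move=> y yc; apply: Sc; rewrite inE yc orbT.
Qed.

Lemma low_all x d n : low x d (x ^+ d) -> low x d (x ^+ n).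
Proof.
move=> xd; elim/ltn_ind: n => n IH; have [nd|dn] := ltnP n d; first exact: low_exp.
case: d xd dn IH => [|d] xd dn IH.
  have x0 : x ^+ 0 = 0 by exact: xd.
  by rewrite -[x ^+ n]mulr1 -(expr0 x) x0 mulr0; apply: sspan0.
have -> : n = (d.+1 + (n - d.+1))%N by rewrite subnKC.
rewrite exprD; set k := (n - d.+1)%N.
apply: (sspan_min (U := fun y => low x d.+1 (y * x ^+ k))) xd => [|u v|s _ Ss /mapP[i + ->]].
- by rewrite mul0r; apply: sspan0.
- by rewrite mulrDl; apply: lowD.
rewrite mem_iota => /andP[_ id]; rewrite -mulrA -exprD; apply: sspanM => //.
by apply: IH; rewrite /k; lia.
Qed.

Lemma low_subalg x d : low x d (x ^+ d) -> subalg_pred (low x d).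
Proof.
move=> xd; split=> [||y y' yd y'd]; first exact: sspan_subspace.
  by rewrite -(expr0 x); apply: low_all.
apply: sspan_trans (sspan_mul yd y'd) => _ /allpairsP[[a b] /= [ad bd ->]].
move: ad bd => /mapP[i _ ->] /mapP[j _ ->]; rewrite -exprD.
exact: low_all.
Qed.

End SubalgSpan.

Lemma low_nagata S x W D c d : subalg_pred S ->
  {in nagata_shift x W D c, forall y, S y} ->
  low S x d (x ^+ d) -> {in c, forall y, low S x d y}.
Proof.
move=> SP + xd; elim: c W => // a c IH W Sc y; rewrite inE => /predU1P[->|yc].
  rewrite -[a](subrK (x ^+ W)) -[a - _]mulr1 -(expr0 x).
  apply: lowD => //; last exact: low_all.
  apply: sspanM => //; last exact: low_all.
  by apply: (Sc (a - x ^+ W)); rewrite mem_head.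
apply: (IH (W * D)%N) yc => z zc; apply: Sc; rewrite /= inE zc orbT.
by [].
Qed.

Lemma nagata_central x W D c : central x -> {in c, forall y, central y} ->
  {in nagata_shift x W D c, forall y, central y}.
Proof.
move=> xC; elim: c W => // a c IH W cC y; rewrite inE => /predU1P[->|].
  apply: (subalgB central_subalg); first by apply: cC; rewrite mem_head.
  exact: (subalgX W central_subalg xC).
by apply: IH => z zc; apply: cC; rewrite inE zc orbT.
Qed.

Lemma size_nagata x W D c : size (nagata_shift x W D c) = size c.
Proof. by elim: c W => //= a c IH W; rewrite IH. Qed.

Lemma mon_add c e e' : {in c, forall y, central y} ->
  size e = size c -> size e' = size c ->
  exists2 e'', size e'' = size c & mon c e * mon c e' = mon c e''.
Proof.
elim: c e e' => [|a c IH] [|i e] [|j e'] //= cC; first by move=> _ _; exists [::]; rewrite ?mulr1.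
move=> [se] [se']; have [|e'' se'' eE] := IH e e' _ se se'.
  by move=> y yc; apply: cC; rewrite inE yc orbT.
exists ((i + j)%N :: e''); first by rewrite /= se''.
have aC : central (a ^+ j).
  by apply: (subalgX j central_subalg); apply: cC; rewrite mem_head.
by rewrite /= exprD -eE -!mulrA -(centralCA _ _ aC).
Qed.

Lemma mon_mem c y : y \in c -> exists2 e, size e = size c & y = mon c e.
Proof.
have mon0 c' : mon c' (nseq (size c') 0%N) = 1.
  by elim: c' => //= a c' ->; rewrite mulr1.
elim: c => // a c IH; rewrite inE => /predU1P[->|/IH[e se ->]].
  by exists (1%N :: nseq (size c) 0%N); rewrite /= ?size_nseq // mon0 mulr1.
by exists (0%N :: e); rewrite /= ?se // expr0 mul1r.
Qed.

Lemma kgen_mon c x : {in c, forall y, central y} -> kgen c x ->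
  exists2 es, {in es, forall e, size e = size c} & kspan (map (mon c) es) x.
Proof.
move=> cC.
pose P x := exists2 es, {in es, forall e, size e = size c} & kspan (map (mon c) es) x.
have P1 e : size e = size c -> P (mon c e).
  move=> se; exists [:: e] => [e'|]; first by rewrite inE => /eqP ->.
  by apply: kspan_mem; rewrite mem_head.
suff PP : subalg_pred P by move=> /(_ P PP); apply=> y /mon_mem[e se ->]; apply: P1.
have P0 : P 0 by exists [::].
have PD k u v : P u -> P v -> P (k *: u + v).
  move=> [es esc eu] [es' esc' ev]; exists (es ++ es') => [e|].
    by rewrite mem_cat => /orP[/esc|/esc'].
  rewrite map_cat; apply: kspanD; last first.
    by apply: kspan_sub ev => y; rewrite mem_cat orbC => ->.
  by apply: kspanZ; apply: kspan_sub eu => y; rewrite mem_cat => ->.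
split=> [//||u v [es esc eu] [es' esc' ev]].
  have -> : (1 : B) = mon c (nseq (size c) 0%N).
    by elim: c {cC P P1 P0 PD} => //= a c' <-; rewrite mulr1.
  by apply: P1; rewrite size_nseq.
have UP : subspace_pred P by split.
apply: kspan_min UP _ (kspan_mul eu ev) => _ /allpairsP[[a b] /= [/mapP[e ee ->] /mapP[e' ee' ->] ->]].
have [e'' se'' ->] := mon_add cC (esc _ ee) (esc' _ ee'); exact: P1.
Qed.

(** The relation is nontrivial because [e0] is not in [es], so it can be solved for its heaviest
    term with nonzero coefficient. The induction is on a bound for the weights in [es]: a top term
    with coefficient zero is dropped. *)
Lemma dominant_relation (V : lmodType K) (T : eqType) (f : T -> V) (v : T -> nat)
    (e0 : T) (es : seq T) :
  {in e0 :: es &, injective v} -> e0 \notin es -> kspan (map f es) (f e0) ->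
  exists2 e1, e1 \in e0 :: es &
    kspan (map f [seq e <- e0 :: es | (v e < v e1)%N]) (f e1).
Proof.

suff main m' : {in es, forall e, v e < m'}%N -> {in e0 :: es &, injective v} ->
    e0 \notin es -> kspan (map f es) (f e0) ->
    exists2 e1, e1 \in e0 :: es &
      kspan (map f [seq e <- e0 :: es | (v e < v e1)%N]) (f e1).
  by apply: (main (\max_(e <- es) (v e).+1)) => e ees; apply: leq_bigmax_seq.
elim: m' es => [|m' IH] es esm vI e0es fe0.
  case: es esm vI e0es fe0 => [_ _ _ /= fe0|e es esm]; last by have := esm e (mem_head _ _).
  by exists e0; rewrite ?mem_head //= ltnn /= fe0.
have [vm|vm] := leqP m' (v e0).
  exists e0; first exact: mem_head.
  apply: kspan_sub fe0 => _ /mapP[e ees ->]; apply: map_f.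
  rewrite mem_filter inE ees orbT andbT ltn_neqAle (leq_trans _ vm) ?andbT; last first.
    by rewrite -ltnS; apply: esm.
  apply: contra e0es => /eqP /vI <- //; rewrite ?mem_head //.
  by rewrite inE ees orbT.
pose es' := [seq e <- es | (v e < m')%N].
have es'es : {subset es' <= es} by move=> e; rewrite mem_filter => /andP[].
have sub' : {subset e0 :: es' <= e0 :: es}.
  by move=> e; rewrite !inE => /predU1P[->|/es'es ->]; rewrite ?eqxx ?orbT.
have IH' : kspan (map f es') (f e0) -> exists2 e1, e1 \in e0 :: es &
    kspan (map f [seq e <- e0 :: es | (v e < v e1)%N]) (f e1).
  move=> fe0'; have [|||e1 e1es' fe1] := IH es' _ _ _ fe0'.
  - by move=> e; rewrite mem_filter => /andP[].
  - by move=> x y /sub' xe /sub' ye; apply: vI.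
  - by apply: contra e0es => /es'es.
  exists e1; first exact: sub'.
  apply: kspan_sub fe1 => _ /mapP[e + ->]; rewrite mem_filter => /andP[ve /sub' ee].
  by apply: map_f; rewrite mem_filter ve.
have [/hasP[em emes /eqP vem]|/hasPn nem] := boolP (has (fun e => v e == m') es); last first.
  apply: IH'; apply: kspan_sub fe0 => _ /mapP[e ees ->]; apply: map_f.
  by rewrite mem_filter ees andbT ltn_neqAle nem //= -ltnS esm.
have : kspan (f em :: map f es') (f e0).
  apply: kspan_sub fe0 => _ /mapP[e ees ->]; rewrite inE.
  have [vlt|] := ltnP (v e) m'; first by rewrite map_f ?orbT // mem_filter vlt.
  move=> vge; rewrite (vI e em) ?eqxx // ?inE ?ees ?emes ?orbT //.
  by apply/eqP; rewrite vem eqn_leq vge andbT -ltnS esm.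
move=> [a [z [zes' fE]]]; have [a0|a0] := eqVneq a 0.
  by apply: IH'; rewrite fE a0 scale0r add0r.
exists em; first by rewrite inE emes orbT.
have -> : f em = a^-1 *: (f e0 - z) by rewrite fE addrK scalerA mulVf // scale1r.
apply: kspanZ; apply: kspanD; last apply: kspanN.
  by apply: kspan_mem; apply: map_f; rewrite mem_filter mem_head vem vm.
apply: kspan_sub zes' => _ /mapP[e + ->]; rewrite mem_filter => /andP[ve ees].
by apply: map_f; rewrite mem_filter vem ve inE ees orbT.
Qed.

Lemma digit_val_inj D e e' : size e = size e' ->
  {in e, forall i, i < D}%N -> {in e', forall i, i < D}%N ->
  digit_val D e = digit_val D e' -> e = e'.
Proof.
elim: e e' => [|i e IH] [|j e'] //= [se] eD e'D vE.
have iD : (i < D)%N by apply: eD; rewrite mem_head.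
have jD : (j < D)%N by apply: e'D; rewrite mem_head.
have ij : i = j.
  by have := congr1 (modn^~ D) vE; rewrite ![(_ + D * _)%N]addnC ![(D * _)%N]mulnC !modnMDl !modn_small.
rewrite ij; congr (_ :: _); apply: IH => //.
- by move=> k ke; apply: eD; rewrite inE ke orbT.
- by move=> k ke; apply: e'D; rewrite inE ke orbT.
move: vE; rewrite ij => /addnI /eqP; rewrite eqn_pmul2l ?(leq_ltn_trans _ iD) //.
by move=> /eqP.
Qed.

(** The given [u] lies anywhere in [B]. It shows that the module [x ^ N B], generated by the
    [x ^+ N * m], equals [x] times itself, so [nakayama] supplies a replacement inside [kgen c]. *)
Lemma pi_regular_relation c ms x : {in c, forall y, central y} -> x \in c ->
  (forall b, sspan (kgen c) ms b) ->
  (exists N u, x ^+ N = x ^+ N.+1 * u) ->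
  exists N g, kgen c g /\ x ^+ N = x ^+ N.+1 * g.
Proof.
move=> cC xc Bms [N [u xN]]; have SP := kgen_subalg c.
have SC y : kgen c y -> central y by apply: kgen_central.
have Sx := kgen_mem xc; have SxN := subalgX N SP Sx.
have [||g Sg gE] := @nakayama (kgen c) SP SC x [seq x ^+ N * m | m <- ms].
- exact: Sx.
- move=> _ /mapP[m mms ->]; exists (x ^+ N * (u * m)); last first.
    by rewrite mulrA -exprS mulrA -xN.
  apply: (sspan_min (U := fun b => sspan (kgen c) [seq x ^+ N * m | m <- ms] (x ^+ N * b))) (Bms (u * m)).
  + by rewrite mulr0; apply: sspan0.
  + by move=> a b aS bS; rewrite mulrDr; apply: sspanD.
  move=> s m' Ss m'ms; rewrite -(centralCA _ _ (SC _ Ss)); apply: sspanM => //.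
  by apply: sspan_mem => //; apply: map_f.
exists N, g; split=> //; rewrite exprSr -mulrA.
rewrite -[LHS]mulr1 -[RHS]mulr1.
apply: (sspan_min (U := fun b => x ^+ N * b = x ^+ N * (x * g) * b)) (Bms 1).
- by rewrite !mulr0.
- by move=> a b aE bE; rewrite !mulrDr aE bE.
move=> s m Ss mms; rewrite -!(centralCA _ _ (SC _ Ss)).
congr (s * _); rewrite [LHS](gE _ (map_f _ mms)).
by rewrite !mulrA -!(SC _ SxN) !mulrA.
Qed.

(* Noether normalisation: the relation [x ^+ N = x ^+ N.+1 * g] is nontrivial
   because its left-hand monomial has [x]-degree [N], all others more. *)
Lemma nagata_step x c ms : {in x :: c, forall y, central y} ->
  (forall b, sspan (kgen (x :: c)) ms b) ->
  (exists N g, kgen (x :: c) g /\ x ^+ N = x ^+ N.+1 * g) ->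
  exists c' ms', [/\ size c' = size c, {in c', forall y, central y}
    & forall b, sspan (kgen c') ms' b].
Proof.
move=> cC Bms [N [g [gc xN]]].
have xC : central x by apply: cC; rewrite mem_head.
have c2C : {in c, forall y, central y} by move=> y yc; apply: cC; rewrite inE yc orbT.
have [es ses ges] := kgen_mon cC gc.
pose up (e : seq nat) := (N.+1 + head 0 e)%N :: behead e.
pose e0 := N :: nseq (size c) 0%N.
pose es' := map up es.
have monup e : size e = (size c).+1 -> mon (x :: c) (up e) = x ^+ N.+1 * mon (x :: c) e.
  by case: e => //= i e _; rewrite exprD mulrA.
have mon0 : mon (x :: c) e0 = x ^+ N.
  by rewrite /= (_ : mon c _ = 1) ?mulr1 //; elim: (c) => //= a c' ->; rewrite mulr1.
have ses' : {in e0 :: es', forall e, size e = (size c).+1}.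
  move=> e; rewrite inE => /predU1P[->|/mapP[e' e'es ->]]; first by rewrite /= size_nseq.
  by rewrite /= size_behead ses.
have rel : kspan (map (mon (x :: c)) es') (mon (x :: c) e0).
  rewrite mon0 xN.
  apply: (kspan_min (U := fun y => kspan _ (x ^+ N.+1 * y))) ges.
    split=> [|k u v us vs]; first by rewrite mulr0; case: (kspan_subspace (map (mon (x :: c)) es')).
    by rewrite mulrDr -scalerAr; apply: (kspan_subspace _).2.
  move=> _ /mapP[e ees ->]; rewrite -monup ?ses //.
  by apply: kspan_mem; do 2?apply: map_f.
(* A base exceeding every exponent that occurs, so that [digit_val D] is injective on
   [e0 :: es']. *)
pose D := (\max_(e <- e0 :: es') \max_(i <- e) i).+1.
have eD e : e \in e0 :: es' -> {in e, forall i, i < D}%N.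
  move=> ees i ie; rewrite ltnS.
  have ile : (i <= \max_(i <- e) i)%N by apply: (leq_bigmax_seq (F := id)).
  apply: leq_trans ile _.
  exact: (leq_bigmax_seq (F := fun e : seq nat => \max_(i <- e) i)).
have [|||e1 e1es rel1] := @dominant_relation _ _ (mon (x :: c)) (digit_val D) e0 es'.
- move=> e e' ees e'es; apply: digit_val_inj; [|exact: eD..].
  by rewrite !ses'.
- by apply/mapP => -[e ees [NE _]]; lia.
- exact: rel.
(* The element [x] itself has weight 1, so the weights of [c] start at [D]. *)
set c' := nagata_shift x D D c; set S := kgen c'.
have c'C : {in c', forall y, central y} by apply: nagata_central.
have SP : subalg_pred S by apply: kgen_subalg.
have SC y : S y -> central y by apply: kgen_central.
have c'S : {in c', forall y, S y} by move=> y; apply: kgen_mem.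
have monic e : e \in e0 :: es' -> monic_at S x (digit_val D e) (mon (x :: c) e).
  move=> /ses'; case: e => //= i e [se]; apply: (monic_atM SP SC).
    exact: monic_at_exp.
  exact: (monic_at_mon SP SC).
set d := digit_val D e1 in rel1 *.
(* [x] is integral over [S]: the monomial of [e1] is monic of degree [d], yet it is a combination of
   monomials of smaller degree. *)
have xd : low S x d (x ^+ d).
  rewrite -[x ^+ d](subKr (mon (x :: c) e1)); apply: (lowB SP); last exact: monic.
  apply: kspan_min rel1; first exact: sspan_subspace.
  move=> _ /mapP[e + ->]; rewrite mem_filter => /andP[ed ees].
  by apply: (low_sub SP ed); apply: (monic_at_low SP); apply: monic.
have lowP := low_subalg SP SC xd.
have clow y : kgen (x :: c) y -> low S x d y.
  move=> /(_ _ lowP); apply=> z; rewrite inE => /predU1P[->|zc].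
    by rewrite -(expr1 x); apply: low_all.
  exact: (low_nagata SP c'S xd).
exists c', [seq y * m | y <- mkseq (fun i => x ^+ i) d, m <- ms].
split=> // [|b]; first exact: size_nagata.
apply: sspan_min (Bms b).
- exact: sspan0.
- exact: sspanD.
move=> s m Ss mms; apply: (sspan_mul SP SC (clow _ Ss)).
exact: sspan_mem.
Qed.

Lemma pi_regular_findim c ms : {in c, forall y, central y} ->
  (forall b, sspan (kgen c) ms b) ->
  (forall h, central h -> exists N u, h ^+ N = h ^+ N.+1 * u) ->
  exists s, forall b : B, kspan s b.
Proof.
move: {2}(size c) (erefl (size c)) => r.
elim: r c ms => [|r IH] [|x c] ms //= sc cC Bms pireg.
  exists ms => b; apply: sspan_min (Bms b).
  - by case: (kspan_subspace ms).
  - by move=> u v; apply: kspanD.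
  move=> s m /kgen_nil[k ->] mms; rewrite -scalerAl mul1r.
  by apply: kspanZ; apply: kspan_mem.
have [|c' [ms' [sc' c'C Bms']]] := @nagata_step x c ms cC Bms.
  apply: (pi_regular_relation cC (mem_head _ _) Bms).
  by apply: pireg; apply: cC; rewrite mem_head.
by apply: (IH c' ms') => //; rewrite sc'; case: sc.
Qed.

End CentralSubalgebras.

(** * Finite dimension of corners *)

Lemma findim_algP (K : fieldType) (A : algType K) :
  findim_alg A <-> exists s : seq A, forall a, kspan s a.
Proof. by split=> -[s sA]; exists s => a; apply/kspanP. Qed.

Lemma fingen_ind (K : fieldType) (A : algType K) (g : seq A) (P : A -> Prop) :
  (forall a : A, exists (ws : seq (seq A)) (cs : seq K),
      all (fun w => all (fun x => x \in g) w) ws /\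
      a = \sum_(i < size ws) cs`_i *: word_val (nth [::] ws i)) ->
  subspace_pred P -> P 1 -> (forall y a, y \in g -> P a -> P (y * a)) ->
  forall a, P a.
Proof.
move=> gA PP P1 PM a; have [ws [cs [/allP wsg ->]]] := gA a.
apply: subspace_pred_sum => // i _; apply: subspace_predZ => //.
have := wsg _ (mem_nth [::] (ltn_ord i)); elim: (nth _ _ _) => //= y w IH.
by move=> /andP[yg wg]; apply: PM => //; apply: IH.
Qed.

Lemma kgen_mono (K : fieldType) (B : algType K) (c c' : seq B) x :
  {subset c <= c'} -> kgen c x -> kgen c' x.
Proof. by move=> cc' xc S SP c'S; apply: xc => // y /cc' /c'S. Qed.

Lemma sspan_mono (K : fieldType) (B : algType K) (S S' : B -> Prop) ms y :
  (forall x, S x -> S' x) -> sspan S ms y -> sspan S' ms y.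
Proof.
move=> SS'; elim: ms y => //= m ms IH y [s [z [Ss zs ->]]].
by exists s, z; split; [apply: SS' | apply: IH |].
Qed.

Section Corner.
Variables (K : fieldType) (E B : algType K).
Variables (mu : {additive B -> E}) (tau : {additive E -> B}).
Hypotheses (muM : {morph mu : x y / x * y}) (muK : cancel mu tau).
Hypothesis mu_tau : forall X, mu (tau X) = mu 1 * X * mu 1.

Lemma corner_mull b X : b * tau X = tau (mu b * X).
Proof.
apply: (can_inj muK); rewrite muM !mu_tau !mulrA -muM mulr1.
by rewrite -muM mul1r.
Qed.

Lemma corner_mulr b X : tau X * b = tau (X * mu b).
Proof.
apply: (can_inj muK); rewrite muM !mu_tau -!mulrA -muM mul1r.
by rewrite -muM mulr1.
Qed.

(** As [mu] is only additive and multiplicative, the scalars of [E] act on [B] through these central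
    elements, which may differ from the scalars of [B]. *)
Definition corner_scalar (k : K) : B := tau (k *: mu 1).

Lemma corner_scalarE k X : corner_scalar k * tau X = tau (k *: X).
Proof.
have muz : mu (corner_scalar k) = k *: mu 1.
  by rewrite mu_tau -scalerAr -scalerAl -!muM !mulr1.
by rewrite corner_mull muz -scalerAl scalerAr -corner_mull mul1r.
Qed.

Lemma corner_scalar_central k : central (corner_scalar k).
Proof.
move=> b; rewrite corner_mulr corner_mull; congr (tau _).
by rewrite -scalerAr -scalerAl -!muM mulr1 mul1r.
Qed.

(** The powers of [mu h] are linearly dependent over the scalars of [E]. Factoring [mu (h ^+ N.+1)]
    out of the relation and applying [tau] gives [u]. *)
Lemma corner_pi_regular (s : seq E) (h : B) : (forall X, kspan s X) ->
  exists N u, h ^+ N = h ^+ N.+1 * u.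
Proof.
move=> sE.
have [N _ [c cE]] := kspan_dependent_min (x := fun i => mu (h ^+ i)) (fun i => sE _).
exists N, (tau (\sum_(N.+1 <= i < (size s).+1) c i *: mu (h ^+ (i - N.+1)))).
rewrite corner_mull -[LHS]muK cE; congr (tau _).
rewrite mulr_sumr; apply: eq_big_nat => i /andP[Ni _].
by rewrite -scalerAr -muM -exprD subnKC.
Qed.

(** Writing the finite list [L] over [s] uses finitely many scalars of [E]; [cs] collects their
    images in the centre of [B]. *)
Lemma corner_coefs (s L : seq E) : {in L, forall Z, kspan s Z} ->
  exists2 cs : seq B, {in cs, forall y, central y} &
    {in L, forall Z, sspan (kgen cs) (map tau s) (tau Z)}.
Proof.
elim: L => [|Z L IH] Ls; first by exists [::].
have [|cs csC csL] := IH; first by move=> X XL; apply: Ls; rewrite inE XL orbT.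
have [cs' cs'C cs'Z] : exists2 cs : seq B, {in cs, forall y, central y} &
    sspan (kgen cs) (map tau s) (tau Z).
  have := Ls Z (mem_head _ _); elim: (s) (Z) => [|X s' IHs] Y /=.
    by move=> ->; exists [::] => //=; rewrite raddf0.
  move=> [k [W [/IHs[cs' cs'C cs'W] ->]]].
  exists (corner_scalar k :: cs') => [y|].
    by rewrite inE => /predU1P[->|/cs'C //]; apply: corner_scalar_central.
  exists (corner_scalar k), (tau W); split; first by apply: kgen_mem; rewrite mem_head.
    apply: sspan_mono cs'W => y; apply: kgen_mono => z; rewrite inE orbC => -> //.
  by rewrite corner_scalarE raddfD.
exists (cs' ++ cs) => [y|X]; first by rewrite mem_cat => /orP[/cs'C|/csC].
rewrite inE => /predU1P[->|XL].
  by apply: sspan_mono cs'Z => y; apply: kgen_mono => z; rewrite mem_cat => ->.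
by apply: sspan_mono (csL X XL) => y; apply: kgen_mono => z; rewrite mem_cat orbC => ->.
Qed.

(** With [L] containing [mu 1] and the products [mu y * X] for generators [y], the module spanned by
    [map tau s] over [kgen cs] contains [1] and is stable under left multiplication by generators.
    It is therefore all of [B], and [pi_regular_findim] applies. *)
Lemma corner_findim : findim_alg E -> fingen_alg B -> findim_alg B.
Proof.
move=> /findim_algP[s sE] [g gB]; apply/findim_algP.
have [//|cs csC csL] :=
  @corner_coefs s (mu 1 :: [seq mu y * X | y <- g, X <- s]).
apply: (pi_regular_findim (c := cs) (ms := map tau s)) => //; last first.
  by move=> h _; apply: corner_pi_regular sE.
have SP := kgen_subalg cs.
have SC y : kgen cs y -> central y by apply: kgen_central.
apply: (fingen_ind gB); first exact: sspan_subspace.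
  by rewrite -[1]muK; apply: csL; rewrite mem_head.
move=> y a yg.
apply: (sspan_min (U := fun a => sspan _ _ (y * a))) => [||k _ Sk /mapP[X Xs ->]].
- by rewrite mulr0; apply: sspan0.
- by move=> u v; rewrite mulrDr; apply: sspanD.
rewrite -(centralCA _ _ (SC _ Sk)); apply: sspanM => //.
by rewrite corner_mull; apply: csL; rewrite inE; apply/orP; right; apply: allpairs_f.
Qed.

End Corner.

(** * Growth of corners *)

Section Words.
Variable R : pzRingType.
Implicit Types (s : seq R) (b : R).

(** The last factor [b] allows words in a corner to end in its unit [mu 1], which may differ from
    the unit of the big ring. *)
Fixpoint words s b k : seq R :=
  if k is k'.+1 then [seq y * w | y <- s, w <- words s b k'] else [:: b].

Lemma size_words s b k : size (words s b k) = (size s ^ k)%N.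
Proof. by elim: k => //= k IH; rewrite size_allpairs IH expnS. Qed.

Lemma words_split s b j k w : w \in words s b (j + k) ->
  exists u v, [/\ u \in words s 1 j, v \in words s b k & w = u * v].
Proof.
elim: j w => [|j IH] w; first by exists 1, w; rewrite /= mem_head mul1r.
move=> /allpairsP[[y w'] /= [ys /IH[u [v [uj vk ->]]] ->]].
by exists (y * u), v; rewrite mulrA; split=> //; apply: allpairs_f.
Qed.

Lemma words_mul s b j k u v : u \in words s 1 j -> v \in words s b k ->
  u * v \in words s b (j + k).
Proof.
elim: j u => [|j IH] u /=; first by rewrite inE => /eqP ->; rewrite mul1r.
by move=> /allpairsP[[y w] /= [ys wj ->]] vk; rewrite -mulrA; apply: allpairs_f => //; apply: IH.
Qed.

End Words.

Section CommutativeMonomials.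
Variable K : fieldType.
Implicit Types C : seq K.

(** Each exponent is bounded by [m] separately. This exceeds what total degree [m] requires, but
    keeps the count polynomial in [m]. *)
Fixpoint monomials C m : seq K :=
  if C is c :: C' then [seq c ^+ i * d | i <- iota 0 m.+1, d <- monomials C' m]
  else [:: 1].

Lemma size_monomials C m : size (monomials C m) = (m.+1 ^ size C)%N.
Proof. by elim: C => // c C IH; rewrite [LHS]size_allpairs size_iota IH -expnS. Qed.

Lemma mem_monomials_cons c C m i d : (i <= m)%N -> d \in monomials C m ->
  c ^+ i * d \in monomials (c :: C) m.
Proof.
move=> im dC; apply/allpairsP; exists (i, d); split=> //=.
by rewrite -[_ :: _]/(iota 0 m.+1) mem_iota; lia.
Qed.

Lemma monomialsS C m d : d \in monomials C m -> d \in monomials C m.+1.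
Proof.
elim: C d => // c C IH d /allpairsP[[i e] /= [im eC ->]].
apply: mem_monomials_cons; last exact: IH.
by move: im; rewrite -[_ :: _]/(iota 0 m.+1) mem_iota; lia.
Qed.

Lemma monomialsM C m c d :
  c \in C -> d \in monomials C m -> c * d \in monomials C m.+1.
Proof.
elim: C d => // c' C IH d cC /allpairsP[[i e] /= [im eC ->]].
move: im; rewrite -[_ :: _]/(iota 0 m.+1) mem_iota => im.
have [<-|cc'] := eqVneq c c'.
  rewrite mulrA -exprS; apply: mem_monomials_cons; last exact: monomialsS.
  by lia.
rewrite mulrCA; apply: mem_monomials_cons; first by lia.
by apply: IH => //; move: cC; rewrite inE (negPf cc').
Qed.

Lemma monomials1 C m : 1 \in monomials C m.
Proof.
elim: C => [|c C IH]; first exact: mem_head.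
by have := mem_monomials_cons c (leq0n m) IH; rewrite expr0 mulr1.
Qed.

Variable E : lmodType K.

(** The coefficients are confined to a finite list because [tau] does not commute with scalars:
    products of coefficients have to be counted along with the words. *)
Fixpoint coef_span C (X : seq E) (Z : E) : Prop :=
  if X is m :: X' then exists c z, [/\ c \in C, coef_span C X' z & Z = c *: m + z]
  else Z = 0.

Lemma coef_span_sub C C' X Z : {subset C <= C'} -> coef_span C X Z -> coef_span C' X Z.
Proof.
move=> CC'; elim: X Z => //= m X IH Z [c [z [cC zX ->]]].
by exists c, z; split; [apply: CC' | apply: IH |].
Qed.

Lemma coef_span_exists (X L : seq E) : {in L, forall Z, kspan X Z} ->
  exists C, {in L, forall Z, coef_span C X Z}.
Proof.
elim: L => [|Z L IH] LX; first by exists [::].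
have [|C CL] := IH; first by move=> Y YL; apply: LX; rewrite inE YL orbT.
have [C' C'Z] : exists C', coef_span C' X Z.
  have := LX Z (mem_head _ _); elim: (X) (Z) => [|m X' IHX] Y /=; first by exists [::].
  move=> [c [z [/IHX[C' C'z] ->]]]; exists (c :: C'), c, z.
  by split=> //; [exact: mem_head | apply: coef_span_sub C'z => y yC; rewrite inE yC orbT].
exists (C' ++ C) => Y; rewrite inE => /predU1P[->|YL].
  by apply: coef_span_sub C'Z => y; rewrite mem_cat => ->.
by apply: coef_span_sub (CL Y YL) => y; rewrite mem_cat orbC => ->.
Qed.

Lemma coef_span_min C X Z (D : E -> Prop) : D 0 ->
  (forall u v, D u -> D v -> D (u + v)) ->
  (forall c m, c \in C -> m \in X -> D (c *: m)) -> coef_span C X Z -> D Z.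
Proof.
move=> D0 DD; elim: X Z => [Z _ -> //|m X IH Z DX [c [z [cC zX ->]]]].
apply: DD; first by apply: DX; rewrite ?mem_head.
by apply: IH zX => c' m' c'C m'X; apply: DX; rewrite // inE m'X orbT.
Qed.

End CommutativeMonomials.

Section CornerGrowth.
Variables (K : fieldType) (E B : algType K).
Variables (mu : {additive B -> E}) (tau : {additive E -> B}).
Hypotheses (muM : {morph mu : x y / x * y}) (muK : cancel mu tau).

(* Since the coefficients in [C] commute, words of length [m] in them give only
   polynomially many monomials; [mu] and [tau] are merely additive, whence the
   additively closed [D] in place of a [K]-span. *)
Lemma corner_words (Y : seq B) (X : seq E) C l m (D : E -> Prop) :
  {in words Y 1 l, forall w, coef_span C X (mu w)} ->
  D 0 -> (forall u v, D u -> D v -> D (u + v)) ->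
  (forall d Z, d \in monomials C m -> Z \in words X (mu 1) m -> D (d *: Z)) ->
  {in words Y 1 (l * m), forall w, D (mu w)}.
Proof.
move=> YC; elim: m D => [|m IH] D D0 DD DZ w.
  rewrite muln0 inE => /eqP ->; rewrite -[mu 1]scale1r; apply: DZ; last exact: mem_head.
  exact: monomials1.
rewrite mulnS => /words_split[u [v [ul vm ->]]]; rewrite muM.
apply: (IH (fun V => D (mu u * V))) vm => [|V V' DV DV'|d Z dC ZX].
- by rewrite mulr0.
- by rewrite mulrDr; apply: DD.
apply: (coef_span_min (D := fun U => D (U * (d *: Z)))) (YC u ul) => [|U V DU DV|c x cC xX].
- by rewrite mul0r.
- by rewrite mulrDl; apply: DD.
rewrite -scalerAl -scalerAr scalerA; apply: DZ; first exact: monomialsM.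
exact: allpairs_f.
Qed.

Lemma corner_growth (Y : seq B) (X : seq E) l :
  {in words Y 1 l, forall w, kspan X (mu w)} ->
  exists p, forall m,
    rank_le (kspan (words Y 1 (l * m))) (m.+1 ^ p * size X ^ m).
Proof.
move=> YX; have [|C CY] := @coef_span_exists _ _ X (map mu (words Y 1 l)).
  by move=> _ /mapP[w wl ->]; apply: YX.
(* The exponent depends on [l] through [C], but not on [m]. *)
exists (size C) => m.
pose s := [seq tau (d *: Z) | d <- monomials C m, Z <- words X (mu 1) m].
exists s; first by rewrite size_allpairs size_monomials size_words.
move=> x; apply: kspan_trans => w wm; rewrite -[w]muK.
have [s0 _] := kspan_subspace s.
apply: (@corner_words Y X C l m (fun U => kspan s (tau U))) wm => [w' w'l||u v us vs|d Z dC ZX].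
- by apply: CY; apply: map_f.
- by rewrite raddf0.
- by rewrite raddfD; apply: kspanD.
apply: kspan_mem.
exact: (allpairs_f (fun d Z => tau (d *: Z))).
Qed.

End CornerGrowth.

(** * Matrix algebras over [A] as [K]-algebras *)

Section MatrixAlgebra.
Variables (K : fieldType) (A : algType K) (n : nat).

(** The alias carries the entrywise action of [K] instead of that of [A]; the size [n.+1] keeps the
    ring nonzero. *)
Definition matalg := 'M[A]_n.+1.
HB.instance Definition _ := GRing.NzRing.on matalg.

Definition matalg_scale (k : K) (X : matalg) : matalg := map_mx ( *:%R k) X.

Fact matalg_scaleA k k' X : matalg_scale k (matalg_scale k' X) = matalg_scale (k * k') X.
Proof. by apply/matrixP => i j; rewrite !mxE scalerA. Qed.

Fact matalg_scale1 : left_id 1 matalg_scale.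
Proof. by move=> X; apply/matrixP => i j; rewrite !mxE scale1r. Qed.

Fact matalg_scaleDr : right_distributive matalg_scale +%R.
Proof. by move=> k X Y; apply/matrixP => i j; rewrite !mxE scalerDr. Qed.

Fact matalg_scaleDl X : {morph matalg_scale^~ X : k k' / k + k'}.
Proof. by move=> k k'; apply/matrixP => i j; rewrite !mxE scalerDl. Qed.

HB.instance Definition _ := GRing.Zmodule_isLmodule.Build K matalg
  matalg_scaleA matalg_scale1 matalg_scaleDr matalg_scaleDl.

Fact matalg_scaleAl (k : K) (X Y : matalg) : k *: (X * Y) = (k *: X) * Y.
Proof.
apply/matrixP => i j; rewrite !mxE scaler_sumr.
by apply: eq_bigr => l _; rewrite !mxE scalerAl.
Qed.

HB.instance Definition _ := GRing.Lmodule_isLalgebra.Build K matalg matalg_scaleAl.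

Fact matalg_scaleAr (k : K) (X Y : matalg) : k *: (X * Y) = X * (k *: Y).
Proof.
apply/matrixP => i j; rewrite !mxE scaler_sumr.
by apply: eq_bigr => l _; rewrite !mxE scalerAr.
Qed.

HB.instance Definition _ := GRing.Lalgebra_isAlgebra.Build K matalg matalg_scaleAr.

Definition entrywise (U : A -> Prop) (X : matalg) := forall i j, U (X i j).

Lemma rank_le_entrywise (U : A -> Prop) N :
  rank_le U N -> rank_le (entrywise U) (n.+1 * n.+1 * N).
Proof.
move=> [s sN sU].
pose e (t : 'I_n.+1 * 'I_n.+1) (a : A) : matalg := a *: delta_mx t.1 t.2.
exists [seq e t a | t <- enum {: 'I_n.+1 * 'I_n.+1}, a <- s].
  by rewrite size_allpairs -cardE card_prod !card_ord leq_mul2l sN orbT.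
move=> X UX; have -> : X = \sum_(t : 'I_n.+1 * 'I_n.+1) e t (X t.1 t.2).
  by rewrite {1}[X]matrix_sum_delta pair_big.
rewrite big_enum_val /=.
apply: subspace_pred_sum; first exact: kspan_subspace.
move=> t _; set t' := enum_val t.
apply: (kspan_min (U := fun a => kspan _ (e t' a))) (sU _ (UX t'.1 t'.2)).
  split=> [|k u v us vs].
    by rewrite /e scale0r; case: (kspan_subspace [seq e t a | t <- enum {: 'I_n.+1 * 'I_n.+1}, a <- s]).
  have -> : e t' (k *: u + v) = k *: e t' u + e t' v.
    by apply/matrixP => i j; rewrite !mxE mulrDl scalerAl.
  exact: (kspan_subspace _).2.
move=> a sa; apply: kspan_mem; apply: allpairs_f => //.
by rewrite mem_enum.
Qed.

Lemma matalg_findim : findim_alg A -> findim_alg matalg.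
Proof.
move=> /findim_algP[s sA]; apply/findim_algP.
have [|s' _ s'P] := @rank_le_entrywise (fun=> True) (size s); first by exists s.
by exists s' => X; apply: s'P.
Qed.

End MatrixAlgebra.

(** * Entropy and growth *)

Section LimnEsup.
Local Open Scope classical_set_scope.
Variable R : realType.
Implicit Types (u : nat -> \bar R) (a : \bar R).

Lemma limn_esup_lt_ev u a : (limn_esup u < a)%E ->
  exists N, forall n, (N <= n)%N -> (u n < a)%E.
Proof.
move=> /ereal_inf_lt[_ /= [A [N _ NA] <-] supA]; exists N => n Nn.
apply: le_lt_trans supA; apply: ereal_sup_ubound; exists n => //.
exact: NA.
Qed.

Lemma limn_esup_le_ev u a N :
  (forall n, (N <= n)%N -> (u n <= a)%E) -> (limn_esup u <= a)%E.
Proof.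
move=> ua; apply: (@le_trans _ _ (ereal_sup (u @` [set n | (N <= n)%N]))).
  apply: ereal_inf_lbound; exists [set n | (N <= n)%N] => //.
  by exists N.
by apply: ub_ereal_sup => _ [n /= Nn <-]; apply: ua.
Qed.

Lemma limn_esup_ge_freq u a :
  (forall N, exists2 n, (N <= n)%N & (a <= u n)%E) -> (a <= limn_esup u)%E.
Proof.
move=> ua; apply: le_ereal_inf_tmp => _ [A [N _ NA] <-].
have [n Nn /le_trans] := ua N; apply; apply: ereal_sup_ubound; exists n => //.
exact: NA.
Qed.

End LimnEsup.

Section Filtrations.
Variables (R : realType) (K : fieldType) (A : algType K) (V : nat -> A -> Prop).
Hypothesis VF : filtration V.

Lemma filtration_subspace n : subspace_pred (V n).
Proof. exact: VF.1. Qed.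

Lemma filtration_le m n x : (m <= n)%N -> V m x -> V n x.
Proof.
move=> /subnK <- Vx; elim: (n - m)%N => // k IH; rewrite addSn.
by case: VF => _ [_ VS _ _ _]; apply: VS.
Qed.

Lemma qdimP n : is_qdim V n (qdim V n).
Proof.
rewrite /qdim; apply: xgetPex.
have fd : fd_quot V n by case: VF => _ [_ _ _ _]; apply.
pose P d := `[< exists2 s, spans_mod V n s & size s = d >].
have exP : exists d, P d by have [s sn] := fd; exists (size s); apply/asboolP; exists s.
have [d /asboolP[s sn sd] dmin] := ex_minnP exP.
exists d; split; first by exists s.
by move=> s' s'n; apply: dmin; apply/asboolP; exists s'.
Qed.

Lemma qdim_rank_le n N : rank_le (V n) N -> (qdim V n <= N)%N.
Proof.
move=> [s sN sV]; have [s' ss' [s'V Vs']] := steinitz (filtration_subspace n) sV.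
apply: leq_trans (leq_trans ss' sN); apply: (qdimP n).2; split=> // v /Vs'/kspanP[cs vE].
by exists cs, 0; rewrite addr0; split=> //; case: (filtration_subspace n.-1).
Qed.

Lemma rank_le_qdim n N : rank_le (V n) N -> rank_le (V n.+1) (N + qdim V n.+1).
Proof.
move=> [s sN sV]; have [[t [[_ tV] st]] _] := qdimP n.+1.
exists (s ++ t); first by rewrite size_cat st leq_add2r.
move=> v /tV[cs [r [/= rV ->]]]; apply: kspanD.
  have : kspan t (\sum_(i < size t) cs`_i *: t`_i) by apply/kspanP; exists cs.
  by apply: kspan_sub => x; rewrite mem_cat orbC => ->.
by apply: kspan_sub (sV _ rV) => x; rewrite mem_cat => ->.
Qed.

Lemma rank_le0 : rank_le (V 0) 0.
Proof. by exists [::] => // x; case: VF => _ [V0 _ _ _ _] /V0. Qed.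

Lemma rank_le_finite n : exists N, rank_le (V n) N.
Proof.
elim: n => [|n [N Nn]]; first by exists 0; apply: rank_le0.
by exists (N + qdim V n.+1)%N; apply: rank_le_qdim.
Qed.

(** If all quotients beyond step [N] vanished, the filtration would stop at the finite-dimensional
    [V N]. *)
Lemma infdim_qdim N : ~ findim_alg A -> exists2 n, (N < n)%N & (0 < qdim V n)%N.
Proof.
move=> nfd; apply: contrapT => nex; apply: nfd; apply/findim_algP.
have [M [s _ sV]] := rank_le_finite N; exists s => a.
have [_ [_ _ Vex _ _]] := VF; have [n Vn] := Vex a.
suff VN k : forall x, V (N + k) x -> V N x.
  by apply: sV; apply: (VN n); apply: filtration_le Vn; rewrite leq_addl.
elim: k => [|k IH] x; first by rewrite addn0.
rewrite addnS => Vx; apply: IH.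
have [[t [[_ tV] st]] _] := qdimP (N + k).+1.
have t0 : t = [::].
  apply: size0nil; rewrite st; apply/eqP; rewrite -leqn0 leqNgt; apply/negP => q0.
  by apply: nex; exists (N + k).+1 => //; rewrite ltnS leq_addr.
by have [cs [r [rV ->]]] := tV x Vx; rewrite t0 big_ord0 add0r.
Qed.

(** Entropy measures successive quotients, whereas the constructions control whole steps. The next
    lemmas show that positive exponential rates agree for both. *)
Definition growth_le (a : R) := exists C : R, forall n, exists2 N,
  rank_le (V n) N & N%:R <= C * expR (a * n%:R).

Lemma halgE : ~ findim_alg A -> halg R V = limn_esup (fun n : nat =>
         if qdim V n == 0%N then -oo%E
         else ((ln ((qdim V n)%:R : R)) / n%:R)%:E).
Proof. by move=> nfd; rewrite /halg; case: asboolP. Qed.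

Lemma halg_ge0 : ~ findim_alg A -> (0 <= halg R V)%E.
Proof.
move=> nfd; rewrite halgE //; apply: limn_esup_ge_freq => N.
have [n Nn qn] := infdim_qdim N nfd; exists n; first exact: ltnW.
rewrite gtn_eqF // lee_fin divr_ge0 // ln_ge0 //.
by rewrite ler1n.
Qed.

Lemma growth_le_halg a : ~ findim_alg A -> growth_le a -> (halg R V <= a%:E)%E.
Proof.
move=> nfd [C CV]; rewrite halgE //; apply/lee_addgt0Pr => e e0.
(* From this index on [|C| <= e * n <= expR (e * n)], so the constant is absorbed. *)
pose N := (Num.trunc (`|C| / e)).+1.
apply: (@limn_esup_le_ev _ _ _ N) => n Nn.
have [_|q0] := eqVneq; first by rewrite leNye.
have n0 : 0 < n%:R :> R by rewrite ltr0n; apply: leq_trans Nn.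
rewrite lee_fin ler_pdivrMr //.
have q0' : 0 < (qdim V n)%:R :> R by rewrite ltr0n lt0n.
rewrite -[leRHS]expRK ler_ln ?posrE ?expR_gt0 //.
have [M MV MC] := CV n; have qM := qdim_rank_le MV.
apply: le_trans (le_trans _ MC) _; first by rewrite ler_nat.
rewrite mulrDl expRD mulrC ler_wpM2l ?expR_ge0 //.
apply: le_trans (expR_ge1Dx _); apply: le_trans (ler_norm C) _.
apply: (@le_trans _ _ (e * n%:R)); last by rewrite lerDr ler01.
rewrite -ler_pdivrMl // [_^-1 * _]mulrC.
apply: ltW; apply: (lt_le_trans (truncnS_gt _)).
by rewrite ler_nat.
Qed.

Lemma halg_growth_le a : ~ findim_alg A -> 0 < a -> (halg R V < a%:E)%E ->
  growth_le a.
Proof.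
move=> nfd a0; rewrite halgE // => /limn_esup_lt_ev[N uN].
have qle n : (N <= n)%N -> (0 < n)%N -> (qdim V n)%:R <= expR (a * n%:R) :> R.
  move=> Nn n0; have := uN n Nn; case: eqVneq => [->|q0]; first by rewrite expR_ge0.
  have n0' : 0 < n%:R :> R by rewrite ltr0n.
  rewrite lte_fin ltr_pdivrMr // => qa.
  rewrite -[(qdim V n)%:R]lnK ?posrE ?ltr0n ?lt0n // ler_expR.
  exact: ltW.
have [M MN] := rank_le_finite N.
have ea : 1 < expR a by rewrite expR_gt1.
(* The second summand is the one for which [C + expR a <= expR a * C], closing the induction that
   adds one quotient at a time. *)
pose C : R := M%:R + expR a / (expR a - 1).
have C1 : 0 <= expR a / (expR a - 1) by rewrite divr_ge0 ?expR_ge0 // subr_ge0 ltW.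
have C0 : 0 <= C by rewrite addr_ge0.
exists C => n; have [nN|] := leqP n N.
  exists M; first by apply: rank_le_sub MN => x; apply: filtration_le.
  apply: (@le_trans _ _ C); first by rewrite lerDl.
  by rewrite ler_peMr // -expR0 ler_expR mulr_ge0 // ltW.
move=> /ltnW /subnKC <-; elim: (n - N)%N => [|k [M' M'V M'C]].
  rewrite addn0; exists M => //; apply: (@le_trans _ _ C); first by rewrite lerDl.
  by rewrite ler_peMr // -expR0 ler_expR mulr_ge0 // ltW.
rewrite addnS; exists (M' + qdim V (N + k).+1)%N; first exact: rank_le_qdim.
rewrite natrD; set x := expR (a * (N + k)%:R) in M'C *.
have x0 : 0 <= x by rewrite expR_ge0.
have xE : expR (a * (N + k).+1%:R) = expR a * x.
  by rewrite -natr1 mulrDr mulr1 addrC expRD.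
have qx := qle (N + k).+1 (leqW (leq_addr _ _)) isT.
rewrite xE in qx *; apply: le_trans (lerD M'C qx) _.
rewrite mulrCA -[X in _ + X]mul1r.
have -> : C * x + 1 * (expR a * x) = (C + expR a) * x by ring.
rewrite mulrA ler_wpM2r //.
rewrite -subr_ge0.
have -> : expR a * C - (C + expR a) = (expR a - 1) * C - expR a by ring.
rewrite subr_ge0 /C mulrDr [X in _ + X]mulrC divfK ?gt_eqF ?subr_gt0 //.
by rewrite lerDr mulr_ge0 // subr_ge0 ltW.
Qed.

End Filtrations.

(** * Filtrations by word length with prescribed growth *)

Section WordFiltration.
Variables (K : fieldType) (B : algType K) (g : seq B).
Hypothesis gB : forall a : B, exists (ws : seq (seq B)) (cs : seq K),
  all (fun w => all (fun x => x \in g) w) ws /\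
  a = \sum_(i < size ws) cs`_i *: word_val (nth [::] ws i).

Definition word_space (k : nat) : B -> Prop := kspan (words (1 :: g) 1 k).

Lemma word_spaceS k x : word_space k x -> word_space k.+1 x.
Proof.
apply: kspan_sub => w wk; rewrite -[w]mul1r.
by apply: (allpairs_f (fun y w => y * w)); rewrite ?mem_head.
Qed.

Lemma word_space_le j k x : (j <= k)%N -> word_space j x -> word_space k x.
Proof.
move=> /subnK <- xj; elim: (k - j)%N => // i IH; rewrite addSn.
exact: word_spaceS.
Qed.

Lemma word_spaceM j k x y : word_space j x -> word_space k y ->
  word_space (j + k) (x * y).
Proof.
move=> xj yk; apply: kspan_sub (kspan_mul xj yk) => _ /allpairsP[[u v] /= [uj vk ->]].
exact: words_mul.
Qed.

Lemma word_space_split j k x : word_space (j + k) x ->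
  kspan [seq x * y | x <- words (1 :: g) 1 j, y <- words (1 :: g) 1 k] x.
Proof.
apply: kspan_sub => w /words_split[u [v [uj vk ->]]].
exact: allpairs_f.
Qed.

Lemma word_space_exhaustive b : exists k, word_space k b.
Proof.
move: b; apply: (fingen_ind gB).
- split=> [|k u v [i ui] [j vj]]; first by exists 0%N; case: (kspan_subspace (words (1 :: g) 1 0)).
  exists (maxn i j); apply: (kspan_subspace _).2.
    by apply: word_space_le ui; apply: leq_maxl.
  by apply: word_space_le vj; apply: leq_maxr.
- by exists 0%N; apply: kspan_mem; rewrite mem_head.
move=> y a yg [k ak]; exists (1 + k)%N; apply: word_spaceM => //.
apply: kspan_mem; rewrite -[y]mulr1.
by apply: (allpairs_f (fun y w => y * w)); rewrite ?inE ?yg ?orbT.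
Qed.

Lemma word_rank_exists k : exists N, `[< rank_le (word_space k) N >].
Proof. by exists (size (words (1 :: g) 1 k)); apply/asboolP; exists (words (1 :: g) 1 k). Qed.

Definition word_rank k : nat := ex_minn (word_rank_exists k).

Lemma word_rankP k : rank_le (word_space k) (word_rank k).
Proof. by rewrite /word_rank; case: ex_minnP => N /asboolP. Qed.

Lemma word_rank_min k N : rank_le (word_space k) N -> (word_rank k <= N)%N.
Proof. by rewrite /word_rank => kN; case: ex_minnP => M _; apply; apply/asboolP. Qed.

Lemma word_rank_le j k : (j <= k)%N -> (word_rank j <= word_rank k)%N.
Proof.
move=> jk; apply: word_rank_min; apply: rank_le_sub (word_rankP k) => x.
exact: word_space_le.
Qed.

Lemma word_rankD j k : (word_rank (j + k) <= word_rank j * word_rank k)%N.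
Proof.
have [s ss sj] := word_rankP j; have [t st tk] := word_rankP k.
apply: word_rank_min; exists [seq x * y | x <- s, y <- t].
  by rewrite size_allpairs leq_mul.
move=> x /word_space_split; apply: kspan_trans => _ /allpairsP[[u v] /= [uj vk ->]].
by apply: kspan_mul; [apply: sj | apply: tk]; apply: kspan_mem.
Qed.

Lemma word_rank0 : (word_rank 0 <= 1)%N.
Proof. by apply: word_rank_min; exists (words (1 :: g) 1 0). Qed.

(** A step equal to its successor is stable under left multiplication by generators. *)
Lemma word_space_stable k : (forall x, word_space k.+1 x -> word_space k x) ->
  findim_alg B.
Proof.
move=> kS; apply/findim_algP; exists (words (1 :: g) 1 k).
apply: (fingen_ind gB); first exact: kspan_subspace.
  by apply: (word_space_le (leq0n k)); apply: kspan_mem; rewrite mem_head.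
move=> y a yg ak; apply: kS; apply: (@word_spaceM 1 k) => //.
apply: kspan_mem; rewrite -[y]mulr1.
by apply: (allpairs_f (fun y w => y * w)); rewrite ?inE ?yg ?orbT.
Qed.

Lemma word_rank_unbounded N : ~ findim_alg B -> exists k, (N < word_rank k)%N.
Proof.
move=> nfd; apply: contrapT => nex.
have exx k : exists x, word_space k.+1 x /\ ~ word_space k x.
  apply: contrapT => nx; apply: nfd; apply: (@word_space_stable k) => y yk.
  by apply: contrapT => nyk; apply: nx; exists y.
have [x xk] := choice exx.
have [s sN sW] : rank_le (word_space N.+1) N.
  apply: rank_leW (word_rankP N.+1); rewrite leqNgt; apply/negP => lt.
  by apply: nex; exists N.+1.
(* The sequence is reversed so that the least index picks the latest vector [x (N - j)], which then
   lies in the span of earlier ones, against its choice. *)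
have [|j js [c xE]] := @kspan_dependent_min _ _ s (fun i => x (N - i)%N).
  by move=> i; apply: sW; apply: word_space_le (xk _).1; lia.
apply: (xk (N - j)%N).2; rewrite xE.
apply: subspace_pred_sum; first exact: kspan_subspace.
move=> i; rewrite mem_index_iota => /andP[ji iN]; apply: kspanZ.
by apply: word_space_le (xk _).1; lia.
Qed.

(** Step 0 is separate because a filtration starts at zero, while [word_space 0] contains [1]. *)
Definition reparam (phi : nat -> nat) (n : nat) (x : B) : Prop :=
  if n is 0 then x = 0 else word_space (phi n) x.

Lemma reparam_filtration (phi : nat -> nat) :
  (forall m n, phi m + phi n <= phi (m + n))%N ->
  (forall k, exists n, k <= phi n)%N ->
  filtration (reparam phi).
Proof.
move=> phiD phioo.
have phi_le m n : (m <= n)%N -> (phi m <= phi n)%N.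
  by move=> /subnK <-; apply: leq_trans (phiD _ _); rewrite leq_addl.
have sub n : subspace_pred (reparam phi n).
  case: n => [|n]; last exact: kspan_subspace.
  by split=> // k u v /= -> ->; rewrite scaler0 addr0.
split=> [//|]; split=> [//|[|n] x|b|[|m] [|n] x y|n].
- by move=> ->; case: (sub 1%N).
- by apply: word_space_le; apply: phi_le.
- have [k bk] := word_space_exhaustive b; have [n kn] := phioo k.
  by exists n.+1; apply: word_space_le bk; apply: leq_trans kn _; apply: phi_le.
- by move=> /= -> _; rewrite mul0r.
- by move=> /= -> _; rewrite mul0r; case: (sub (0 + n.+1)%N).
- by move=> /= _ ->; rewrite mulr0; case: (sub (m.+1 + 0)%N).
- by move=> xm yn; apply: word_space_le (word_spaceM xm yn); apply: phiD.
case: n => [|n]; first by exists [::]; split=> // v /= ->; exists [::], 0; rewrite big_ord0 addr0.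
exists (words (1 :: g) 1 (phi n.+1)); split=> [x|v /kspanP[cs ->]]; first exact: kspan_mem.
by exists cs, 0; rewrite addr0; split=> //; case: (sub n).
Qed.

Section Attain.
Variables (R : realType) (psi : nat -> R).
Hypotheses (psi_ge0 : forall n, 0 <= psi n)
  (psiD : forall m n, psi m + psi n <= psi (m + n)%N)
  (psi_oo : forall x, exists n, x <= psi n).

Lemma word_filtration_growth : ~ findim_alg B -> 
  exists2 G : nat -> B -> Prop, filtration G &
  (forall n, exists2 N, rank_le (G n) N & N%:R <= expR (psi n)) /\
  (exists D : R, forall n N, (0 < n)%N -> rank_le (G n) N ->
     expR (psi n) <= D * N%:R).
Proof.
move=> nfd; pose P n k := (word_rank k)%:R <= expR (psi n).
have exP n : exists k, P n k.
  exists 0%N; apply: (@le_trans _ _ 1); last by rewrite -expR0 ler_expR.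
  by rewrite (ler_nat _ _ 1) word_rank0.
(* The maximum defining [phi n] exists because ranks are unbounded in infinite dimension. *)
have bdP n : exists M, forall k, P n k -> (k <= M)%N.
  have [M MP] := word_rank_unbounded (Num.trunc (expR (psi n))) nfd.
  exists M => k Pk; rewrite leqNgt; apply/negP => /ltnW /word_rank_le Mk.
  have : (word_rank k <= Num.trunc (expR (psi n)))%N.
    by rewrite truncn_ge_nat ?expR_ge0.
  by rewrite leqNgt (leq_trans MP Mk).
have [M MP] := choice bdP.
pose phi n := ex_maxn (exP n) (MP n).
have phiP n : P n (phi n) by rewrite /phi; case: ex_maxnP.
have phi_max n k : P n k -> (k <= phi n)%N.
  by rewrite /phi; case: ex_maxnP => m _ mmax; apply: mmax.
have phiD m n : (phi m + phi n <= phi (m + n))%N.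
  apply: phi_max; rewrite /P.
  apply: (@le_trans _ _ ((word_rank (phi m))%:R * (word_rank (phi n))%:R)).
    by rewrite -natrM ler_nat word_rankD.
  apply: (@le_trans _ _ (expR (psi m) * expR (psi n))).
    by rewrite ler_pM //; apply: phiP.
  by rewrite -expRD ler_expR.
exists (reparam phi).
  apply: reparam_filtration => // k; have [n kn] := psi_oo (word_rank k)%:R.
  exists n; apply: phi_max; apply: le_trans kn _.
  by apply: le_trans (expR_ge1Dx _); rewrite lerDr ler01.
split=> [[|n]|].
- by exists 0%N; [exists [::] | rewrite expR_ge0].
- by exists (word_rank (phi n.+1)); [apply: word_rankP | apply: phiP].
(* By maximality of [phi n], one more letter overshoots [expR (psi n)], and it multiplies the rank
   by at most [word_rank 1]. *)
exists (word_rank 1)%:R => -[//|n] N _ /word_rank_min rN.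
rewrite -natrM; apply: (@le_trans _ _ (word_rank (phi n.+1).+1)%:R).
  rewrite leNgt; apply/negP => /ltW /phi_max; rewrite ltnn //.
rewrite ler_nat; apply: leq_trans (word_rankD 1 (phi n.+1)) _.
by rewrite leq_mul2l rN orbT.
Qed.

End Attain.

End WordFiltration.

Lemma expR_nat_unbounded (R : realType) (b M : R) : 0 < b ->
  exists2 n, (0 < n)%N & M < expR (b * n%:R).
Proof.
move=> b0; exists (Num.trunc (`|M| / b)).+1 => //.
apply: (lt_le_trans _ (expR_ge1Dx _)); apply: le_lt_trans (ler_norm M) _.
rewrite addrC; apply: ltr_wpDr => //; rewrite -ltr_pdivrMl // [_^-1 * _]mulrC.
exact: truncnS_gt.
Qed.

(** With [b = q / (p + 1)], [k + 2] is at most a constant times [1 + b * k <= expR (b * k)]; the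
    [p]-th power costs only [b * p <= q]. *)
Lemma pow_le_expR (R : realType) (q : R) p : 0 < q ->
  exists C : R, 0 <= C /\ forall k : nat, (k.+2 ^ p)%:R <= C * expR (q * k%:R).
Proof.
move=> q0; pose b := q / p.+1%:R.
have b0 : 0 < b by rewrite divr_gt0.
exists ((2 + b^-1) ^+ p); split=> [|k]; first by rewrite exprn_ge0 // addr_ge0 // invr_ge0 ltW.
have kle : k.+2%:R <= (2 + b^-1) * expR (b * k%:R).
  apply: (@le_trans _ _ ((2 + b^-1) * (1 + b * k%:R))); last first.
    by rewrite ler_wpM2l ?expR_ge1Dx // addr_ge0 // invr_ge0 ltW.
  have -> : (2 + b^-1) * (1 + b * k%:R) = 2 + k%:R + (2 * b * k%:R + b^-1) :> R.
    by field; rewrite gt_eqF.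
  rewrite -addn2 natrD addrC lerDl addr_ge0 ?invr_ge0 ?mulr_ge0 //; exact: ltW.
rewrite natrX; apply: (@le_trans _ _ (((2 + b^-1) * expR (b * k%:R)) ^+ p)).
  by rewrite lerXn2r // nnegrE ?mulr_ge0 ?expR_ge0 // addr_ge0 // invr_ge0 ltW.
rewrite exprMn ler_wpM2l ?exprn_ge0 ?addr_ge0 ?invr_ge0 ?(ltW b0) //.
rewrite -expRM_natr ler_expR mulrAC ler_wpM2r // /b.
rewrite mulrAC ler_pdivrMr // ler_wpM2l ?ler_nat //; exact: ltW.
Qed.

(** * Transfer of subexponential growth to corners *)

Section SubexponentialCorner.
Variables (R : realType) (K : fieldType) (A B : algType K) (n : nat).
Variables (mu : {additive B -> matalg A n}) (tau : {additive matalg A n -> B}).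
Hypotheses (muM : {morph mu : x y / x * y}) (muK : cancel mu tau).
Variables (F : nat -> A -> Prop).
Hypothesis FF : filtration F.

Lemma entrywise_exhaustive (X : matalg A n) : exists k, entrywise (F k) X.
Proof.
have [_ [_ _ Fex _ _]] := FF.
have [k kX] := choice (fun t : 'I_n.+1 * 'I_n.+1 => Fex (X t.1 t.2)).
exists (\max_t k t) => i j; apply: (filtration_le FF _ (kX (i, j))).
exact: leq_bigmax.
Qed.

Lemma entrywiseM k l (X Y : matalg A n) :
  entrywise (F k) X -> entrywise (F l) Y -> entrywise (F (k + l)) (X * Y).
Proof.
move=> Xk Yl i j; rewrite mxE; apply: subspace_pred_sum; first exact: (filtration_subspace FF).
by move=> h _; have [_ [_ _ _ FM _]] := FF; apply: FM.
Qed.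

Lemma subexponential_words (g : seq B) (a : R) : 0 < a ->
  (forall e : R, 0 < e -> growth_le F e) ->
  exists C : R, forall k, exists2 N,
    rank_le (word_space g k) N & N%:R <= C * expR (a * k%:R).
Proof.
(* Half of the rate pays for the polynomial factor, half for the powers of [size X]. *)
move=> a0 FG; have [q q0 aE] : exists2 q, 0 < q & a = q + q.
  by exists (a / 2); [rewrite divr_gt0 | rewrite -splitr].
have [s sY] : exists s, {in 1 :: g, forall y, entrywise (F s) (mu y)}.
  elim: (1 :: g) => [|y Y [s sY]]; first by exists 0%N.
  have [t ty] := entrywise_exhaustive (mu y).
  exists (maxn s t) => z; rewrite inE => /predU1P[->|zY] i j.
    exact: (filtration_le FF (leq_maxr s t)).
  by apply: (filtration_le FF (leq_maxl s t)); apply: sY.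
(* The final factor [mu 1] of a word also costs [s], hence [l.+1]. *)
have sW l : {in words (1 :: g) 1 l, forall w, entrywise (F (s * l.+1)) (mu w)}.
  elim: l => [|l IH] w.
    by rewrite inE => /eqP ->; rewrite muln1; apply: sY; rewrite mem_head.
  move=> /allpairsP[[y v] /= [yY vl ->]]; rewrite muM mulnS.
  by apply: entrywiseM; [apply: sY | apply: IH].
pose e := q / 2 / s.+1%:R.
have e0 : 0 < e by rewrite !divr_gt0.
have [C CF] := FG e e0.
have q20 : 0 < q / 2 by rewrite divr_gt0.
(* By the choice of [e], words of length [l] lie in a space of dimension at most a constant times
   [expR (q / 2 * l)]. This [l] makes that constant smaller than the other half of
   [expR (q * l)]. *)
have [l l0 lC] := expR_nat_unbounded ((n.+1 * n.+1)%:R * `|C| * expR (q / 2)) q20.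
have [N NF NC] := CF (s * l.+1)%N.
have [X sX XF] := rank_le_entrywise n NF.
have Xq : (size X)%:R <= expR (q * l%:R).
  apply: (@le_trans _ _ ((n.+1 * n.+1)%:R * N%:R)); first by rewrite -natrM ler_nat.
  apply: (@le_trans _ _ ((n.+1 * n.+1)%:R * (`|C| * expR (q / 2 * l.+1%:R)))).
    rewrite ler_wpM2l //; apply: le_trans NC _; apply: (@le_trans _ _ (`|C| * expR (e * (s * l.+1)%:R))).
      by rewrite ler_wpM2r ?expR_ge0 // ler_norm.
    rewrite ler_wpM2l // ler_expR natrM mulrA ler_wpM2r // /e mulrAC.
    rewrite ler_pdivrMr // ler_wpM2l ?ler_nat //; exact: ltW.
  rewrite -[l.+1%:R]natr1 mulrDr mulr1 expRD [expR (q / 2 * _) * _]mulrC !mulrA.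
  have -> : q * l%:R = q / 2 * l%:R + q / 2 * l%:R by field.
  by rewrite expRD ler_wpM2r ?expR_ge0 // ltW.
have [|p pW] := @corner_growth _ _ _ mu tau muM muK (1 :: g) X l.
  by move=> w wl; apply: XF; apply: sW.
have [C' [C'0 C'p]] := pow_le_expR p q0.
(* Rounding [k] up to the multiple [l * m] adds at most [l] letters, which accounts for the factor
   [expR (q * l)]. *)
exists (C' * expR (q * l%:R)) => k; pose m := (k %/ l).+1.
exists (m.+1 ^ p * size X ^ m)%N.
  apply: rank_le_sub (pW m) => x; apply: word_space_le.
  by rewrite mulnC; apply: ltnW; apply: ltn_ceil.
have mk : (l * m <= l + k)%N by rewrite mulnS leq_add2l mulnC leq_trunc_div.
rewrite natrM.
apply: (@le_trans _ _ (C' * expR (q * k%:R) * (expR (q * l%:R) ^+ m))).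
  rewrite ler_pM //.
    apply: le_trans (C'p k); rewrite ler_nat; case: (p) => // p'.
    by rewrite leq_exp2r // !ltnS leq_div.
  by rewrite natrX lerXn2r ?nnegrE ?expR_ge0.
rewrite -expRM_natr -!mulrA ler_wpM2l // -!expRD ler_expR.
have -> : q * l%:R + a * k%:R = q * k%:R + q * (l + k)%:R.
  by rewrite natrD aE; ring.
by rewrite lerD2l ler_wpM2l ?(ltW q0) // -natrM ler_nat.
Qed.

End SubexponentialCorner.

(** * Morita transfer and realisation of entropies *)

Lemma morita_corner (K : fieldType) (A B : algType K) : morita_equiv A B ->
  exists (n : nat) (mu : {additive B -> matalg A n}) (tau : {additive matalg A n -> B}),
  [/\ {morph mu : x y / x * y}, cancel mu tau
    & forall X, mu (tau X) = mu 1 * X * mu 1].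
Proof.
move=> [F [G [Fm [Gm [FmP GmP etaP epsP]]]]].
have [[|n] [mu [tau [muM muK mutau]]]] := equivalence_corner FmP GmP etaP epsP.
  (* For [n = 0] the matrix ring is zero, while [mu] embeds the nonzero ring [B] in it. *)
  have /eqP := oner_neq0 B; case; rewrite -[LHS]muK -[RHS]muK; congr (tau _).
  by apply/matrixP => -[].
by exists n, mu, tau.
Qed.

Lemma morita_findim (K : fieldType) (A B : algType K) :
  morita_equiv A B -> fingen_alg B -> findim_alg A -> findim_alg B.
Proof.
move=> /morita_corner[n [mu [tau [muM muK mutau]]]] Bfg /(matalg_findim n) Afd.
exact: (corner_findim muM muK mutau Afd).
Qed.

Lemma subexponential_entropy0 (R : realType) (K : fieldType) (A B : algType K)
    (F : nat -> A -> Prop) : fingen_alg B -> morita_equiv A B -> filtration F ->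
  ~ findim_alg A -> ~ findim_alg B -> halg R F = 0%E ->
  exists2 G : nat -> B -> Prop, filtration G & halg R G = 0%E.
Proof.
move=> [g gB] AB FF Anfd Bnfd F0.
have [n [mu [tau [muM muK _]]]] := morita_corner AB.
have GF : filtration (reparam g id).
  by apply: (reparam_filtration gB) => // k; exists k.
exists (reparam g id) => //; apply/eqP; rewrite eq_le (halg_ge0 R GF Bnfd) andbT.
apply/lee_addgt0Pr => e e0; rewrite add0e; apply: growth_le_halg => //.
have [|C CW] := subexponential_words muM muK FF g e0.
  by move=> e' e'0; apply: halg_growth_le => //; rewrite F0 lte_fin.
exists C => -[|k]; last exact: CW.
exists 0%N; first by exists [::].
have [N _ /(le_trans (ler0n _ N)) CN] := CW 0%N; exact: CN.
Qed.

Lemma growth_le_lower (R : realType) (K : fieldType) (B : algType K)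
    (G : nat -> B -> Prop) (psi : nat -> R) (D a : R) :
  (forall n N, (0 < n)%N -> rank_le (G n) N -> expR (psi n) <= D * N%:R) ->
  growth_le G a ->
  exists C, forall n, (0 < n)%N -> expR (psi n - a * n%:R) <= C.
Proof.
move=> GD [C GC]; exists (`|D| * C) => n n0; have [N GN NC] := GC n.
rewrite expRD expRN ler_pdivrMr ?expR_gt0 //; apply: le_trans (GD n N n0 GN) _.
apply: (@le_trans _ _ (`|D| * N%:R)); first by rewrite ler_wpM2r // ler_norm.
by rewrite -mulrA ler_wpM2l.
Qed.

Lemma positive_entropy (R : realType) (K : fieldType) (B : algType K) (h : \bar R) :
  fingen_alg B -> ~ findim_alg B -> (0 < h)%E ->
  exists2 G : nat -> B -> Prop, filtration G & halg R G = h.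
Proof.
move=> [g gB] Bnfd; case: h => [h|_|]; last by [].
- rewrite lte_fin => h0; pose psi n : R := h * n%:R.
  have psi_ge0 n : 0 <= psi n by rewrite mulr_ge0 // ltW.
  have psiD m n : psi m + psi n <= psi (m + n)%N by rewrite /psi natrD mulrDr.
  have psi_oo x : exists n, x <= psi n.
    exists (Num.trunc (`|x| / h)).+1; apply: le_trans (ler_norm x) _.
    rewrite -ler_pdivrMl // [_^-1 * _]mulrC; apply: ltW; exact: truncnS_gt.
  have [G GF [Gle [D GD]]] := word_filtration_growth gB psi_ge0 psiD psi_oo Bnfd.
  exists G => //; apply/eqP; rewrite eq_le; apply/andP; split.
    apply: growth_le_halg => //; exists 1 => n; have [N GN Nn] := Gle n.
    by exists N => //; rewrite mul1r.
  rewrite leNgt; apply/negP => Gh; have := halg_ge0 R GF Bnfd.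
  case Gr : (halg R G) Gh => [r| |] //; rewrite lte_fin lee_fin => rh r0.
  (* If the entropy [r] were below [h], growth at the midpoint rate would bound an exponential whose
     rate [h - (r + h) / 2] is positive. *)
  have [C GC] : exists C, forall n, (0 < n)%N -> expR (psi n - (r + h) / 2 * n%:R) <= C.
    apply: growth_le_lower GD _; apply: halg_growth_le => //.
      by rewrite divr_gt0 // ltr_wpDl.
    by rewrite Gr lte_fin midf_lt.
  have [|n n0] := @expR_nat_unbounded R (h - (r + h) / 2) C.
    by rewrite subr_gt0 midf_lt.
  by rewrite mulrBl ltNge GC.
pose psi n : R := (n * n)%:R.
have psi_ge0 n : 0 <= psi n by [].
have psiD m n : psi m + psi n <= psi (m + n)%N.
  by rewrite /psi -natrD ler_nat mulnDl !mulnDr -addnA leq_add2l addnA leq_addl.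
have psi_oo x : exists n, x <= psi n.
  exists (Num.trunc `|x|).+1; apply: le_trans (ler_norm x) _; apply: ltW.
  by apply: (lt_le_trans (truncnS_gt _)); rewrite ler_nat leq_pmulr.
have [G GF [Gle [D GD]]] := word_filtration_growth gB psi_ge0 psiD psi_oo Bnfd.
exists G => //; have := halg_ge0 R GF Bnfd.
case Gr : (halg R G) => [r| |] //; rewrite lee_fin => r0.
have [C GC] : exists C, forall n, (0 < n)%N -> expR (psi n - (r + 1) * n%:R) <= C.
  apply: growth_le_lower GD _; apply: halg_growth_le => //.
    by rewrite ltr_wpDl.
  by rewrite Gr lte_fin ltrDl.
(* The bound gives both [expR n > C] and [n >= r + 2]; the latter makes [n ^ 2 - (r + 1) n] at least
   [n]. *)
have [n n0] := @expR_nat_unbounded R 1 (`|C| + expR (r + 2)) ltr01.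
rewrite mul1r => Cn.
have rn : r + 2 <= n%:R.
  by rewrite -ler_expR; apply: le_trans (ltW Cn); rewrite lerDr.
have : expR n%:R <= C.
  apply: le_trans (GC n n0); rewrite ler_expR /psi natrM -mulrBl.
  by rewrite ler_peMl //; lra.
rewrite leNgt => /negP; case; apply: le_lt_trans Cn.
by apply: le_trans (ler_norm C) _; rewrite lerDl expR_ge0.
Qed.

Theorem theorem4p11 (R : realType) (K : fieldType) (A B : algType K) :
  fingen_alg A -> fingen_alg B -> morita_equiv A B ->
  forall F : nat -> A -> Prop, filtration F ->
  exists G : nat -> B -> Prop, filtration G /\ halg R F = halg R G.
Proof.
move=> Afg Bfg AB F FF.
(* If [B] is finite-dimensional, so is [A] by symmetry; both entropies are then 0 by convention,
   whatever the filtration of [B]. *)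
have [Bfd|Bnfd] := pselect (findim_alg B).
  have Afd := morita_findim (morita_equiv_sym AB) Afg Bfd.
  have [g gB] := Bfg; exists (reparam g id); split.
    by apply: (reparam_filtration gB) => // k; exists k.
  by rewrite /halg !asboolT.
have Anfd : ~ findim_alg A by move=> /(morita_findim AB Bfg).
have := halg_ge0 R FF Anfd; rewrite le_eqVlt => /predU1P[F0|Fpos].
  have [G GF G0] := subexponential_entropy0 Bfg AB FF Anfd Bnfd (esym F0).
  by exists G; rewrite G0.
by have [G GF GE] := positive_entropy Bfg Bnfd Fpos; exists G.
Qed.
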